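(* Let $\Omega=(0,1]^2=\Omega_1\,\dot\cup\,\Omega_2$ be a partition into measurable sets of positive measure, let $a_1,a_2,b_{1,1},b_{1,2},c_{1,1},c_{1,2}$ be positive constants with $c_{1,1}<c_{1,2}$, and consider the two-pole Lorentz permittivity $$\epsilon(\cdot,\lambda)=a_1\chi_{\Omega_1}+a_2\chi_{\Omega_2}+\Big(\frac{b_{1,1}}{c_{1,1}-\lambda}+\frac{b_{1,2}}{c_{1,2}-\lambda}\Big)\chi_{\Omega_1}.$$ For $k\in\mathcal K=(-\pi,\pi]^2$ let $A_k$ and $\mathcal A_k$ be the associated self-adjoint operators defined in the context. If $A_k>c_{1,2}$ for all $k\in\mathcal K$, then there is a band gap above $c_{1,1}$, namely $$\Big(c_{1,1},\ c_{1,1}+\frac{c_{1,1}b_{1,1}}{c_{1,2}b_{1,2}+c_{1,1}b_{1,1}}\,(c_{1,2}-c_{1,1})\Big)\subset\rho(\mathcal A_k),\quad k\in\mathcal K=(-\pi,\pi]^2.$$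
   Context: $\mathbb T^2=\mathbb R^2/\mathbb Z^2$, with $\Omega=(0,1]^2$ as unit cell. For $k\in\mathcal K$ the shifted Laplacian in $L^2(\mathbb T^2)$ is $\Delta_k=\langle\nabla+\mathrm ik,\nabla+\mathrm ik\rangle=\Delta+2\mathrm i\langle k,\nabla\rangle-|k|^2$, $\operatorname{dom}\Delta_k=H^2(\mathbb T^2)$; $-\Delta_k$ is self-adjoint with compact resolvent and spectrum $\{|2\pi n+k|^2:n\in\mathbb Z^2\}$. $\chi_{\Omega_m}$ is the characteristic function of $\Omega_m$, also viewed as a multiplication operator. $W:=a_1\chi_{\Omega_1}+a_2\chi_{\Omega_2}$ (multiplication operator in $L^2(\mathbb T^2)$), and $$A_k:=-W^{-1/2}\Delta_kW^{-1/2}+\frac{b_{1,1}+b_{1,2}}{a_1}\chi_{\Omega_1},\qquad\operatorname{dom}A_k=W^{1/2}H^2(\mathbb T^2).$$ $P_1:L^2(\mathbb T^2)\to\operatorname{ran}P_1=\{u\in L^2(\mathbb T^2):u|_{\Omega\setminus\Omega_1}\equiv0\}$ is multiplication by $\chi_{\Omega_1}$, and $B_{1,\ell}:\operatorname{ran}P_1\to L^2(\mathbb T^2)$ is given by $B_{1,\ell}^*=\sqrt{c_{1,\ell}b_{1,\ell}/a_1}\,P_1$, $\ell=1,2$. Finally $$\mathcal A_k=\begin{pmatrix} A_k & B_{1,1} & B_{1,2} \\ B_{1,1}^* & c_{1,1} & 0 \\ B_{1,2}^* & 0 & c_{1,2} \end{pmatrix},\qquad\operatorname{dom}\mathcal A_k=\operatorname{dom}A_k\oplus\operatorname{ran}P_1\oplus\operatorname{ran}P_1,$$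 in $L^2(\mathbb T^2)\oplus\operatorname{ran}P_1\oplus\operatorname{ran}P_1$. The condition $A_k>c_{1,2}$ means $\min\sigma(A_k)>c_{1,2}$. *)

(* Defs.v *)
From HB Require Import structures.
From mathcomp Require Import all_boot all_order all_algebra.
From mathcomp Require Import complex.
From mathcomp Require Import all_classical all_reals all_analysis.
From mathcomp Require Import measurable_realfun.

Set Implicit Arguments.
Unset Strict Implicit.
Unset Printing Implicit Defensive.
Import Order.TTheory GRing.Theory Num.Theory.
Import numFieldNormedType.Exports.

Local Open Scope classical_set_scope.
Local Open Scope ring_scope.
Local Open Scope complex_scope.

(* A complex Hilbert space given by representatives: [hmem] is a linear
   subspace of [hsort], [hdot] is linear in the first argument, and [u], [v] in
   [hmem] stand for the same vector iff [hnorm (u - v) = 0] (as for L^2, the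
   square-integrable functions modulo a.e. equality).  Only the data are
   bundled; the axioms hold for the spaces constructed below. *)
Record hilbert (R : realType) := Hilbert {
  hsort : lmodType R[i];
  hmem : set hsort;
  hdot : hsort -> hsort -> R[i] }.

Section Operators.
Context {R : realType}.

Definition hnorm (H : hilbert R) (u : hsort H) : R :=
  Num.sqrt (complex.Re (hdot u u)).

Definition hsum (H K : hilbert R) : hilbert R :=
  @Hilbert R (hsort H * hsort K)%type
    [set u | hmem u.1 /\ hmem u.2]
    (fun u v => hdot u.1 v.1 + hdot u.2 v.2).

(* A (possibly unbounded) linear operator is given by its graph:
   [A u v] means [u \in dom A] and [A u = v]. *)
Definition operator (H K : hilbert R) := hsort H -> hsort K -> Prop.

Definition adjoint (H K : hilbert R) (T : operator H K) : operator K H :=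
  fun y x => [/\ hmem y, hmem x &
    forall u v, T u v -> hdot v y = hdot u x].

(* [z] is in the resolvent set of [A] iff [A - z : dom A -> H] is injective and
   surjective, with bounded inverse. *)
Definition resolvent_set (H : hilbert R) (A : operator H H) : set R[i] :=
  [set z | [/\ forall u v u' v', A u v -> A u' v' ->
                 hnorm ((v - z *: u) - (v' - z *: u')) = 0 ->
                 hnorm (u - u') = 0,
               forall f, hmem f ->
                 exists u v, A u v /\ hnorm ((v - z *: u) - f) = 0 &
               exists M : R, forall u v, A u v ->
                 hnorm u <= M * hnorm (v - z *: u)]].

Definition spectrum (H : hilbert R) (A : operator H H) : set R[i] :=
  ~` resolvent_set A.

(* min sigma(A) > c.  In [R[i]], [m%:C <= z] means that [z] is real and at least
   [m], so [m] is a minimum of the spectrum as a set of real numbers. *)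
Definition min_spectrum_gt (H : hilbert R) (A : operator H H) (c : R) :=
  exists m : R,
    [/\ spectrum A m%:C, lbound (spectrum A) m%:C & c < m].

End Operators.

Section Torus.
Context {R : realType}.
Local Notation plane := (measurableTypeR R * measurableTypeR R)%type.
Local Notation C := (R[i]^o).

Definition cell : set plane := `]0, 1] `*` `]0, 1].

Definition lebesgue2 : {measure set plane -> \bar R} :=
  (@lebesgue_measure R \x @lebesgue_measure R)%E.

Lemma measurable_cell : measurable cell.
Proof. by apply: measurableX; exact: measurable_itv. Qed.

(* Lebesgue measure of the torus R^2/Z^2: a function on the torus is identified
   with its values on the unit cell. *)
Definition torus_measure : {measure set plane -> \bar R} :=
  mrestr lebesgue2 measurable_cell.

(* The Lebesgue sigma-algebra, i.e. the completion of the Borel one. *)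
Definition lebesgue_measurable2 (A : set plane) :=
  completed_algebra_gen lebesgue2 A.

Definition cintegral (f : plane -> C) : C :=
  (\int[torus_measure]_x complex.Re (f x)) +i*
  (\int[torus_measure]_x complex.Im (f x)).

Definition l2dot (f g : plane -> C) : C := cintegral (fun x => f x * (g x)^*%C).

Definition L2 : hilbert R :=
  @Hilbert R (plane -> C)
    [set f | (fun x => complex.Re (f x)) \in Lfun torus_measure 2%:E /\
             (fun x => complex.Im (f x)) \in Lfun torus_measure 2%:E]
    l2dot.

Definition smooth (f : plane -> R) := forall (vs : seq plane) (x : plane),
  differentiable (foldr (fun v g => 'D_v g) f vs) x.

Definition torus_smooth (f : plane -> C) :=
  [/\ forall (x : plane) (m n : int),
        f ((x.1 : R) + m%:~R, (x.2 : R) + n%:~R) = f x,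
      smooth (fun x => complex.Re (f x)) &
      smooth (fun x => complex.Im (f x))].

Definition partial (v : plane) (f : plane -> C) : plane -> C := fun x =>
  ('D_v (fun y => complex.Re (f y)) x) +i* ('D_v (fun y => complex.Im (f y)) x).

Definition partials (i j : nat) (f : plane -> C) : plane -> C :=
  iter i (partial (1, 0)) (iter j (partial (0, 1)) f).

(* H^2(T^2) is the closure of C^oo(T^2) for the norm
   (sum_(i + j <= 2) ||d_1^i d_2^j f||^2)^(1/2).  [H2_derivatives u D] says that
   u is in H^2(T^2) and that, for i + j <= 2, [D i j] is its generalised
   derivative of order (i, j). *)
Definition H2_derivatives (u : hsort L2) (D : nat -> nat -> hsort L2) :=
  [/\ hmem u, u = D 0%N 0%N %[ae torus_measure] &
  exists phi : nat -> plane -> C,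
    (forall n, torus_smooth (phi n)) /\
    forall i j, (i + j <= 2)%N ->
      hmem (D i j) /\
      (fun n => hnorm ((partials i j (phi n) : hsort L2) - D i j)) @ \oo --> (0 : R)].

Definition shifted_laplacian (k : plane) : operator L2 L2 := fun u v =>
  exists D, [/\ H2_derivatives u D, hmem v &
    v = (fun x => D 2%N 0%N x + D 0%N 2%N x
                  + 2 * 'i%C * (k.1%:C * D 1%N 0%N x + k.2%:C * D 0%N 1%N x)
                  - (k.1 ^+ 2 + k.2 ^+ 2)%:C * u x) %[ae torus_measure]].

Definition quasimomenta : set plane := `]- pi, pi] `*` `]- pi, pi].

Section Lorentz.
Variables (Omega1 Omega2 : set plane) (a1 a2 b11 b12 c11 c12 : R).

Definition W (x : plane) : R := a1 * \1_Omega1 x + a2 * \1_Omega2 x.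

(* [h] stands for [W^(-1/2) u] and [g] for its image under the shifted
   Laplacian; [h] ranges over H^2, so the domain is [W^(1/2) H^2]. *)
Definition opA (k : plane) : operator L2 L2 := fun u v =>
  [/\ hmem u, hmem v &
  exists h g : hsort L2, [/\ shifted_laplacian k h g,
    u = (fun x => (Num.sqrt (W x))%:C * h x) %[ae torus_measure] &
    v = (fun x => - ((Num.sqrt (W x))^-1)%:C * g x
                  + ((b11 + b12) / a1 * \1_Omega1 x)%:C * u x)
        %[ae torus_measure]]].

Definition ranP1 : hilbert R :=
  @Hilbert R (plane -> C)
    [set u | @hmem R L2 u /\
             {ae torus_measure, forall x, (cell `\` Omega1) x -> u x = 0}]
    l2dot.

Definition P1 : operator L2 ranP1 := fun u p =>
  [/\ @hmem R L2 u, @hmem R ranP1 p &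
      p = (fun x => (\1_Omega1 x)%:C * u x) %[ae torus_measure]].

Definition opBstar (c b : R) : operator L2 ranP1 := fun u p =>
  exists q, P1 u q /\ p = (Num.sqrt (c * b / a1))%:C *: q.

(* B_{1,l} is specified through its adjoint. *)
Definition opB (c b : R) : operator ranP1 L2 := adjoint (opBstar c b).

Definition opAA (k : plane) :
    operator (hsum L2 (hsum ranP1 ranP1)) (hsum L2 (hsum ranP1 ranP1)) :=
  fun u v => exists (w f1 f2 : hsort L2) (q1 q2 : hsort ranP1),
    [/\ hmem v,
        [/\ opA k u.1 w, opB c11 b11 u.2.1 f1 & opB c12 b12 u.2.2 f2],
        opBstar c11 b11 u.1 q1 /\ opBstar c12 b12 u.1 q2 &
        [/\ v.1 = w + f1 + f2,
            v.2.1 = q1 + c11%:C *: u.2.1 &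
            v.2.2 = q2 + c12%:C *: u.2.2]].

End Lorentz.
End Torus.

Arguments ranP1 {R} Omega1.
Arguments P1 {R} Omega1.
Arguments opBstar {R} Omega1 a1 c b.
Arguments opB {R} Omega1 a1 c b.
Arguments opAA {R} Omega1 Omega2 a1 a2 b11 b12 c11 c12 k.

(* Main.v *)
Require Import Defs.
From mathcomp Require Import all_boot all_order all_algebra.
From mathcomp Require Import complex.
From mathcomp Require Import all_classical all_reals all_analysis.
From mathcomp Require Import measurable_realfun.
From mathcomp Require Import ring lra.
Import Order.TTheory GRing.Theory Num.Theory.
Import numFieldNormedType.Exports.

Set Implicit Arguments.
Unset Strict Implicit.
Unset Printing Implicit Defensive.

Local Open Scope classical_set_scope.
Local Open Scope ring_scope.
Local Open Scope complex_scope.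

(** Eliminating the two auxiliary components of [opAA - l] leaves the Schur
    complement [A - l + psi P], where [P] is multiplication by the indicator of
    [Omega1] and [psi = - (c11 b11 / (c11 - l) + c12 b12 / (c12 - l)) / a1].
    The endpoint of the gap is exactly the point up to which [psi >= 0].  So
    [A >= m > c12 > l] as a quadratic form gives [A - l + psi P >= m - l > 0],
    and the Schur complement is boundedly invertible.

    No spectral theorem is needed to pass from [min sigma(A) > c12] to the form
    bound.  Green's formula on the torus shows that [A] is symmetric and
    nonnegative; if [A >= s] and [s] is in the resolvent set, then Cauchy-Schwarz
    for the form of [A - s] improves the bound to [A >= s + e], hence
    the best lower bound is at least [m].  Bijectivity of the Schur complement
    is then a Neumann series around [A + psi], which converges because [L2] is
    complete. *)

(** * Symmetric operators in a semi-inner product space *)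

(** The Neumann series does not start from [A] itself because [psi] blows up as [l] decreases to
    [c11]: there [psi P - l] is far larger than the lower bound [m] of [A]. Moving [psi] times the
    identity to the other side leaves [psi P - (l + psi)], which is [- l] on the range of [P] and
    [- (l + psi)] on its orthogonal complement. The ratio of the norms is then below 1 as soon as
    [l < m], whatever the size of [psi].

    Vectors are functions, not classes, so the resolvent is only a choice of solutions up to norm
    zero, with neither linearity nor continuity built in. Estimates are therefore made on
    differences of pairs in the graph, and an equation is established by showing that its residual
    has norm zero.

    Members of [L2] are Borel measurable while [Omega1] is only Lebesgue measurable. It is replaced
    by a Borel set [O1] that agrees with it up to a null set, so that multiplication by the
    indicator stays in the space. *)

Lemma quadratic_discriminant (R : realType) (a b c : R) :
  0 <= c -> (forall t, 0 <= a + 2 * t * b + t ^+ 2 * c) -> b ^+ 2 <= a * c.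
Proof.
rewrite le_eqVlt => /predU1P[<-|c0] H.
  have [->|b0] := eqVneq b 0; first by rewrite expr0n mulr0.
  (* With leading coefficient 0 and [b] nonzero the function of [t] is affine; this is the point
     where it takes the value -1. *)
  have := H (- (a + 1) / (2 * b)).
  have -> : a + 2 * (- (a + 1) / (2 * b)) * b + (- (a + 1) / (2 * b)) ^+ 2 * 0 = -1.
    by field.
  by rewrite oppr_ge0 ler10.
(* The minimiser of the quadratic. *)
have := H (- b / c).
have -> : a + 2 * (- b / c) * b + (- b / c) ^+ 2 * c = a - b ^+ 2 / c.
  by field; rewrite gt_eqF.
by rewrite subr_ge0 ler_pdivrMr.
Qed.

(* Only real parts of inner products and real scalars occur: the argument takes
   place at real points of the resolvent set. *)
Section SemiInnerProduct.
Context {R : realType} (H : hilbert R).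
Implicit Types (u v w : hsort H) (a b : R).

Definition rdot u v : R := complex.Re (hdot u v).

(** There is no definiteness axiom, since a nonzero function may vanish almost everywhere. The
    identities are restricted to members because integrals are additive only for integrable
    functions. *)
Record semi_inner : Prop := SemiInner {
  semi_inner_mem0 : @hmem R H 0;
  semi_inner_memP : forall a u v, hmem u -> hmem v -> hmem (a%:C *: u + v);
  semi_inner_dotC : forall u v, hmem u -> hmem v -> rdot u v = rdot v u;
  semi_inner_dotP : forall a u v w, hmem u -> hmem v -> hmem w ->
    rdot (a%:C *: u + v) w = a * rdot u w + rdot v w;
  semi_inner_dot_ge0 : forall u, hmem u -> 0 <= rdot u u }.

Hypothesis HH : semi_inner.

Lemma hmem0 : @hmem R H 0. Proof. exact: semi_inner_mem0 HH. Qed.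

Lemma hmemD u v : hmem u -> hmem v -> hmem (u + v).
Proof. by move=> hu hv; have := semi_inner_memP HH 1 hu hv; rewrite scale1r. Qed.

Lemma hmemZ a u : hmem u -> hmem (a%:C *: u).
Proof. by move=> hu; have := semi_inner_memP HH a hu hmem0; rewrite addr0. Qed.

Lemma hmemN u : hmem u -> hmem (- u).
Proof. by move=> hu; have := hmemZ (-1) hu; rewrite rmorphN scaleN1r. Qed.

Lemma hmemB u v : hmem u -> hmem v -> hmem (u - v).
Proof. by move=> hu hv; apply/hmemD/hmemN. Qed.

Lemma hmem_sum (f : nat -> hsort H) n :
  (forall i, hmem (f i)) -> hmem (\sum_(i < n) f i).
Proof.
move=> hf; elim: n => [|n IH]; first by rewrite big_ord0; exact: hmem0.
by rewrite big_ord_recr; exact: hmemD.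
Qed.

Lemma rdotC u v : hmem u -> hmem v -> rdot u v = rdot v u.
Proof. exact: semi_inner_dotC HH _ _. Qed.

Lemma rdotDl u v w : hmem u -> hmem v -> hmem w ->
  rdot (u + v) w = rdot u w + rdot v w.
Proof.
by move=> hu hv hw; have := semi_inner_dotP HH 1 hu hv hw; rewrite scale1r mul1r.
Qed.

Lemma rdot0l w : hmem w -> rdot 0 w = 0.
Proof.
move=> hw; have /eqP := rdotDl hmem0 hmem0 hw.
by rewrite addr0 -subr_eq subrr eq_sym => /eqP.
Qed.

Lemma rdotZl a u w : hmem u -> hmem w -> rdot (a%:C *: u) w = a * rdot u w.
Proof.
move=> hu hw; have := semi_inner_dotP HH a hu hmem0 hw.
by rewrite addr0 rdot0l// addr0.
Qed.

Lemma rdotNl u w : hmem u -> hmem w -> rdot (- u) w = - rdot u w.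
Proof.
by move=> hu hw; have := rdotZl (-1) hu hw; rewrite rmorphN scaleN1r mulN1r.
Qed.

Lemma rdotBl u v w : hmem u -> hmem v -> hmem w ->
  rdot (u - v) w = rdot u w - rdot v w.
Proof. by move=> hu hv hw; rewrite rdotDl// ?rdotNl//; exact: hmemN. Qed.

Lemma rdotDr u v w : hmem u -> hmem v -> hmem w ->
  rdot w (u + v) = rdot w u + rdot w v.
Proof.
by move=> hu hv hw; rewrite rdotC ?rdotDl ?(rdotC hw)//; exact: hmemD.
Qed.

Lemma rdotZr a u w : hmem u -> hmem w -> rdot w (a%:C *: u) = a * rdot w u.
Proof. by move=> hu hw; rewrite rdotC ?rdotZl ?(rdotC hw)//; exact: hmemZ. Qed.

Lemma rdotNr u w : hmem u -> hmem w -> rdot w (- u) = - rdot w u.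
Proof. by move=> hu hw; rewrite rdotC ?rdotNl ?(rdotC hw)//; exact: hmemN. Qed.

Lemma rdotBr u v w : hmem u -> hmem v -> hmem w ->
  rdot w (u - v) = rdot w u - rdot w v.
Proof. by move=> hu hv hw; rewrite rdotDr// ?rdotNr//; exact: hmemN. Qed.

Lemma rdot_ge0 u : hmem u -> 0 <= rdot u u.
Proof. exact: semi_inner_dot_ge0 HH _. Qed.

Lemma hnorm_ge0 u : 0 <= hnorm u. Proof. exact: sqrtr_ge0. Qed.

Lemma sqr_hnorm u : hmem u -> hnorm u ^+ 2 = rdot u u.
Proof. by move=> hu; rewrite sqr_sqrtr// rdot_ge0. Qed.

Lemma cauchy_schwarz u v : hmem u -> hmem v ->
  `|rdot u v| <= hnorm u * hnorm v.
Proof.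
move=> hu hv.
rewrite -(@ler_pXn2r _ 2)// ?nnegrE ?mulr_ge0 ?hnorm_ge0//.
rewrite exprMn !sqr_hnorm// real_normK ?num_real//.
apply: quadratic_discriminant => [|t]; first exact: rdot_ge0.
have htv := hmemZ t hv.
have := rdot_ge0 (hmemD hu htv).
rewrite rdotDl ?rdotDr ?rdotZl ?rdotZr//; last exact: hmemD.
by rewrite (rdotC hv hu) => /le_trans; apply; rewrite le_eqVlt; apply/orP; left;
   apply/eqP; ring.
Qed.

Lemma hnormZ a u : hmem u -> hnorm (a%:C *: u) = `|a| * hnorm u.
Proof.
move=> hu; have hau := hmemZ a hu.
rewrite /hnorm -/(rdot _ _) -/(rdot u u) rdotZl// rdotZr// mulrA -expr2.
by rewrite sqrtrM ?sqr_ge0// sqrtr_sqr.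
Qed.

Lemma hnormN u : hmem u -> hnorm (- u) = hnorm u.
Proof.
by move=> hu; have := hnormZ (-1) hu; rewrite rmorphN scaleN1r normrN1 mul1r.
Qed.

Lemma hnormB u v : hmem u -> hmem v -> hnorm (u - v) = hnorm (v - u).
Proof. by move=> hu hv; rewrite -hnormN ?opprB//; exact: hmemB. Qed.

Lemma hnorm0 : hnorm (0 : hsort H) = 0.
Proof. by rewrite /hnorm -/(rdot 0 0) rdot0l ?sqrtr0//; exact: hmem0. Qed.

Lemma hnorm_triangle u v : hmem u -> hmem v -> hnorm (u + v) <= hnorm u + hnorm v.
Proof.
move=> hu hv; have huv := hmemD hu hv.
rewrite -(@ler_pXn2r _ 2)// ?nnegrE ?addr_ge0 ?hnorm_ge0//.
rewrite sqrrD !sqr_hnorm// rdotDl// !rdotDr// (rdotC hv hu).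
have := cauchy_schwarz hu hv; have := ler_norm (rdot u v); lra.
Qed.

Lemma hnorm_triangleB u v : hmem u -> hmem v -> hnorm u <= hnorm v + hnorm (u - v).
Proof.
move=> hu hv; have := hnorm_triangle hv (hmemB hu hv).
by rewrite addrC subrK.
Qed.

Lemma hnorm_eq0_congr u v : hmem u -> hmem v -> hnorm (u - v) = 0 ->
  hnorm u = hnorm v.
Proof.
move=> hu hv uv0; apply/eqP; rewrite eq_le.
have := hnorm_triangleB hu hv; have := hnorm_triangleB hv hu.
by rewrite hnormB// uv0 !addr0 => -> ->.
Qed.

Lemma rdot_eq0l u v : hmem u -> hmem v -> hnorm u = 0 -> rdot u v = 0.
Proof.
move=> hu hv u0; have := cauchy_schwarz hu hv.
by rewrite u0 mul0r normr_le0 => /eqP.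
Qed.

Lemma cvg_rdot (f g : nat -> hsort H) u v : (forall n, hmem (f n)) ->
  (forall n, hmem (g n)) -> hmem u -> hmem v ->
  (fun n => hnorm (f n - u)) @ \oo --> (0 : R) ->
  (fun n => hnorm (g n - v)) @ \oo --> (0 : R) ->
  (fun n => rdot (f n) (g n)) @ \oo --> rdot u v.
Proof.
move=> hf hg hu hv fu gv.
apply/subr_cvg0/norm_cvg0P.
apply: (squeeze_cvgr (f := fun=> 0) (h := fun n => hnorm (f n - u) *
  (hnorm v + hnorm (g n - v)) + hnorm u * hnorm (g n - v))).
- apply: nearW => n; rewrite normr_ge0/=.
  have -> : rdot (f n) (g n) - rdot u v = rdot (f n - u) (g n) + rdot u (g n - v).
    by rewrite rdotBl// rdotBr// addrA subrK.
  apply: le_trans (ler_normD _ _) _; apply: lerD.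
    apply: le_trans (cauchy_schwarz (hmemB (hf n) hu) (hg n)) _.
    by apply: ler_wpM2l; [exact: hnorm_ge0|exact: hnorm_triangleB].
  by apply: cauchy_schwarz => //; exact: hmemB.
- exact: cvg_cst.
rewrite -[X in _ --> X](addr0 0) -[X in _ --> X + _](mul0r (hnorm v + 0)).
rewrite -[X in _ --> _ + X](mulr0 (hnorm u)).
apply: cvgD; last exact: cvgMr.
by apply: cvgM => //; apply: cvgD => //; exact: cvg_cst.
Qed.

(** Completeness for series with geometrically decaying norms, which is the kind of series that the
    Neumann expansion produces. *)
Definition geometric_complete := forall (f : nat -> hsort H) (c q : R),
  0 <= q < 1 -> (forall n, hmem (f n)) -> (forall n, hnorm (f n) <= c * q ^+ n) ->
  exists F, hmem F /\ (fun n => hnorm (F - \sum_(i < n) f i)) @ \oo --> (0 : R).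

Record symmetric_operator (A : operator H H) : Prop := SymmetricOperator {
  symop_mem : forall u v, A u v -> hmem u /\ hmem v;
  symop_lin : forall a u v u' v', A u v -> A u' v' ->
    A (a%:C *: u + u') (a%:C *: v + v');
  symop_sym : forall u v u' v', A u v -> A u' v' -> rdot v u' = rdot u v' }.

Definition lower_bounded (A : operator H H) (s : R) :=
  forall u v, A u v -> s * rdot u u <= rdot v u.

Section SymmetricOperator.
Variable A : operator H H.
Hypothesis sA : symmetric_operator A.

Let memA1 u v : A u v -> hmem u. Proof. by case/(symop_mem sA). Qed.
Let memA2 u v : A u v -> hmem v. Proof. by case/(symop_mem sA). Qed.

Lemma symop0 u v : A u v -> A 0 0.
Proof.
move=> Auv; have := symop_lin sA (-1) Auv Auv.
by rewrite !rmorphN !scaleN1r !addNr.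
Qed.

Lemma symopB u v u' v' : A u v -> A u' v' -> A (u - u') (v - v').
Proof.
move=> Auv Auv'; have := symop_lin sA (-1) Auv' Auv.
by rewrite !rmorphN !scaleN1r ![- _ + _]addrC.
Qed.

Lemma symop_sum (U V : nat -> hsort H) n : (forall i, A (U i) (V i)) ->
  A (\sum_(i < n) U i) (\sum_(i < n) V i).
Proof.
move=> AUV; elim: n => [|n IH]; first by rewrite !big_ord0; exact: symop0 (AUV 0%N).
rewrite !big_ord_recr/=; have := symop_lin sA 1 IH (AUV n).
by rewrite !scale1r.
Qed.

(* Cauchy-Schwarz for the nonnegative form of [A - s]: with [(A - s) u' = u] it
   gives [|u|^4 <= ((A - s) u, u) (u, u') <= ((A - s) u, u) M |u|^2]. *)
Lemma lower_bounded_resolvent s : lower_bounded A s -> resolvent_set A s%:C ->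
  exists2 e : R, 0 < e & lower_bounded A (s + e).
Proof.
move=> As [_ surj [M bM]].
(* The resolvent bound [M] may be zero or negative; a positive bound is needed because its inverse
   is the gain [e]. *)
pose M' := `|M| + 1.
have M'0 : 0 < M' by rewrite ltr_wpDl.
exists M'^-1 => [|u v Auv]; first by rewrite invr_gt0.
have hu := memA1 Auv; have hv := memA2 Auv.
have [u' [v' [Auv' E]]] := surj u hu.
have hu' := memA1 Auv'; have hv' := memA2 Auv'.
have hw : hmem (v' - s%:C *: u') by apply/hmemB/hmemZ.
have u'M : hnorm u' <= M' * hnorm u.
  have <- := hnorm_eq0_congr hw hu E.
  apply: le_trans (bM _ _ Auv') _; apply: ler_wpM2r; first exact: hnorm_ge0.
  by rewrite (le_trans (ler_norm M))// lerDl.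
have wz z : hmem z -> rdot (v' - s%:C *: u') z = rdot u z.
  move=> hz; apply/eqP; rewrite -subr_eq0 -rdotBl//.
  by rewrite rdot_eq0l//; exact: hmemB.
set p := rdot v u - s * rdot u u.
set r := rdot v' u' - s * rdot u' u'.
have p0 : 0 <= p by rewrite subr_ge0 As.
have r0 : 0 <= r by rewrite subr_ge0 As.
have rE : r = rdot u u' by rewrite -wz// rdotBl ?rdotZl//; exact: hmemZ.
have qE : rdot v u' - s * rdot u u' = rdot u u.
  rewrite (symop_sym sA Auv Auv') (rdotC hu hv') -(wz u hu) rdotBl ?rdotZl//.
    by rewrite (rdotC hu hu').
  exact: hmemZ.
(* The quadratic in [t] is the form of [A - s] at [u + t u']; by [qE] half of its linear coefficient
   is |u|^2. *)
have CS : rdot u u ^+ 2 <= p * r.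
  apply: quadratic_discriminant => // t.
  have At := symop_lin sA t Auv' Auv.
  have := As _ _ At; rewrite -subr_ge0.
  have htu := hmemZ t hu'; have htv := hmemZ t hv'.
  rewrite !rdotDl ?rdotDr ?rdotZl ?rdotZr//; try exact: hmemD.
  rewrite (rdotC hu' hu) (rdotC hv' hu) -(symop_sym sA Auv Auv').
  have {}qE : rdot v u' = rdot u u + s * rdot u u' by rewrite -qE subrK.
  rewrite qE /p /r; by move/le_trans; apply; rewrite le_eqVlt; apply/orP; left; apply/eqP; ring.
have rM : r <= M' * rdot u u.
  rewrite rE (le_trans (ler_norm _))// (le_trans (cauchy_schwarz hu hu'))//.
  rewrite -sqr_hnorm// expr2 mulrCA ler_wpM2l//; exact: hnorm_ge0.
have [u0|u0] := eqVneq (rdot u u) 0.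
  by move: p0; rewrite /p u0 !mulr0 subr0.
have up : 0 < rdot u u by rewrite lt_neqAle eq_sym u0 rdot_ge0.
rewrite mulrDl -lerBrDl -/p.
rewrite mulrC ler_pdivrMr//.
rewrite -(ler_pM2r up) -expr2 (le_trans CS)// -mulrA ler_wpM2l//.
Qed.

(** For fixed [u] the inequality passes to the supremum, so the best lower bound is attained. It
    cannot be [m], which is assumed not to be a bound, and if it were below [m] it would lie in the
    resolvent set and could be improved. *)
Lemma lower_bounded_spectrum m : lower_bounded A 0 ->
  (forall x : R, x < m -> resolvent_set A x%:C) -> lower_bounded A m.
Proof.
move=> A0 res; apply: contrapT => nm.
have down x y : x <= y -> lower_bounded A y -> lower_bounded A x.
  move=> xy Ay u v Auv; apply: le_trans (Ay _ _ Auv).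
  by rewrite ler_wpM2r// rdot_ge0//; exact: memA1 Auv.
pose E := [set x : R | lower_bounded A x].
have Em : ubound E m.
  move=> x Ex; rewrite leNgt; apply/negP => mx; apply: nm.
  exact: down (ltW mx) Ex.
have hsE : has_sup E by split; [exists 0|exists m].
have Es : lower_bounded A (sup E).
  move=> u v Auv; have hu := memA1 Auv.
  have [u0|u0] := eqVneq (rdot u u) 0.
    by have := A0 _ _ Auv; rewrite u0 !mulr0.
  have up : 0 < rdot u u by rewrite lt_neqAle eq_sym u0 rdot_ge0.
  rewrite -ler_pdivlMr//; apply: ge_sup; first by exists 0.
  by move=> x /(_ _ _ Auv); rewrite ler_pdivlMr.
have sm : sup E < m.
  rewrite lt_neqAle ge_sup//; last by exists 0.
  by rewrite andbT; apply/eqP => smE; apply: nm; rewrite -smE.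
have [e e0 Ee] := lower_bounded_resolvent Es (res _ sm).
have := ub_le_sup (ex_intro _ m Em) Ee.
by rewrite leNgt ltrDl e0.
Qed.

(** * Perturbation by a nonnegative multiple of a projection *)

Section Perturbation.
Variables (P : hsort H -> hsort H) (m l psi : R).
Hypotheses (memP : forall u, hmem u -> hmem (P u))
  (linP : forall a u v, P (a%:C *: u + v) = a%:C *: P u + P v)
  (dotP : forall u, hmem u -> rdot (P u) (P u) = rdot (P u) u)
  (Am : lower_bounded A m) (l0 : 0 <= l) (lm : l < m) (psi0 : 0 <= psi).

(** Pair the right-hand vector with [u]: the additional term [psi (P u, u) = psi |P u|^2] is
    nonnegative and can only raise the form. *)
Lemma perturbation_bound u w : A u w ->
  (m - l) * hnorm u <= hnorm (w - l%:C *: u + psi%:C *: P u).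
Proof.
move=> Auw; have hu := memA1 Auw; have hw := memA2 Auw.
have hPu := memP hu; have hlu := hmemZ l hu; have hpu := hmemZ psi hPu.
have hB := hmemB hw hlu; have hS := hmemD hB hpu.
have [->|u0] := eqVneq (hnorm u) 0; first by rewrite mulr0 hnorm_ge0.
have up : 0 < hnorm u by rewrite lt_neqAle eq_sym u0 hnorm_ge0.
rewrite -(ler_pM2r up); apply: le_trans (cauchy_schwarz hS hu).
apply: le_trans (ler_norm _).
rewrite rdotDl// rdotBl// !rdotZl// -dotP// -mulrA -expr2 sqr_hnorm//.
have := Am Auw; have := rdot_ge0 hPu => h1 h2.
by have := mulr_ge0 psi0 h1; lra.
Qed.

(* Neumann series around [A + psi]: the perturbation [psi P - (l + psi)] has
   norm at most [l + psi], which is less than the lower bound [m + psi]. *)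
Lemma perturbation_surjective : geometric_complete ->
  (forall x : R, x < m -> resolvent_set A x%:C) ->
  forall f, hmem f -> exists u w,
    A u w /\ hnorm (w - l%:C *: u + psi%:C *: P u - f) = 0.
Proof.
move=> complete res f hf.
have m0 : 0 < m by exact: le_lt_trans lm.
have mp0 : 0 < m + psi by rewrite ltr_wpDr.
have lp0 : 0 <= l + psi by rewrite addr_ge0.
(* [RR g] is a chosen pair of the graph with [(A + psi) u = g] up to norm zero. It exists because
   [- psi] is at most 0, hence below [m]; outside [hmem] the pair is a dummy. *)
have /choice[RR HR] : forall g, exists uw, hmem g -> A uw.1 uw.2 /\
    hnorm (uw.2 + psi%:C *: uw.1 - g) = 0.
  move=> g; have [hg|hg] := pselect (hmem g); last by exists (0, 0).
  have pm : - psi < m by apply: le_lt_trans m0; rewrite oppr_le0.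
  have [_ /(_ g hg)[u [w [Auw E]]] _] := res _ pm.
  exists (u, w) => _; split=> //=.
  by move: E; rewrite rmorphN scaleNr opprK.
pose K u := psi%:C *: P u - (l + psi)%:C *: u.
have hK u : hmem u -> hmem (K u).
  by move=> hu; apply: hmemB; apply: hmemZ => //; exact: memP.
have KB u v : K (u - v) = K u - K v.
  have PB : P (u - v) = P u - P v.
    have := linP (-1) v u.
    by rewrite !rmorphN !scaleN1r ![- _ + _]addrC.
  by rewrite /K PB !scalerBr !opprD !opprK addrACA.
(* Since [(P u, u) = |P u|^2], expanding gives |K u|^2 = (l + psi)^2 |u|^2 - psi (2 l + psi) |P
   u|^2. *)
have normK u : hmem u -> hnorm (K u) <= (l + psi) * hnorm u.
  move=> hu; have hPu := memP hu.
  rewrite -(@ler_pXn2r _ 2)// ?nnegrE ?mulr_ge0 ?hnorm_ge0//.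
  rewrite exprMn !sqr_hnorm//; last exact: hK.
  have h1 := hmemZ psi hPu; have h2 := hmemZ (l + psi) hu.
  rewrite rdotBl ?rdotBr ?rdotZl ?rdotZr//; try exact: hmemB.
  rewrite (rdotC hu hPu) -dotP//.
  have := mulr_ge0 (mulr_ge0 psi0 (addr_ge0 l0 lp0)) (rdot_ge0 hPu); lra.
have boundA u w : A u w -> (m + psi) * hnorm u <= hnorm (w + psi%:C *: u).
  move=> Auw; have hu := memA1 Auw; have hw := memA2 Auw.
  have hpu := hmemZ psi hu; have hS := hmemD hw hpu.
  have [->|u0] := eqVneq (hnorm u) 0; first by rewrite mulr0 hnorm_ge0.
  have up : 0 < hnorm u by rewrite lt_neqAle eq_sym u0 hnorm_ge0.
  rewrite -(ler_pM2r up); apply: le_trans (cauchy_schwarz hS hu).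
  apply: le_trans (ler_norm _).
  rewrite rdotDl// !rdotZl// -mulrA -expr2 sqr_hnorm// mulrDl lerD2r.
  exact: Am.
(* With R the chosen solution map, [v n] is the n-th iterate of - K R at [f]. The sum [F] should
   satisfy F + K R F = f, so that u = R F solves (A + psi + K) u = f. *)
pose v := fix v n : hsort H := if n is k.+1 then - K (RR (v k)).1 else f.
have hv n : hmem (v n).
  elim: n => //= n /HR[/memA1 h _]; exact/hmemN/hK.
have AR n : A (RR (v n)).1 (RR (v n)).2 by case: (HR _ (hv n)).
pose q := (l + psi) / (m + psi).
have q01 : 0 <= q < 1.
  rewrite divr_ge0 ?(ltW mp0)//=.
  by rewrite ltr_pdivrMr// mul1r ltrD2r.
have normR n : hnorm (RR (v n)).1 <= (m + psi)^-1 * hnorm (v n).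
  rewrite mulrC ler_pdivlMr// mulrC.
  have [Auw E] := HR _ (hv n).
  rewrite -(hnorm_eq0_congr _ (hv n) E); first exact: boundA.
  by apply: hmemD; [exact: memA2 Auw|apply/hmemZ/memA1/Auw].
have vq n : hnorm (v n) <= hnorm f * q ^+ n.
  elim: n => [|n IH]; first by rewrite expr0 mulr1.
  rewrite /= hnormN; last exact/hK/memA1/AR.
  apply: le_trans (normK _ (memA1 (AR n))) _.
  apply: (@le_trans _ _ (q * hnorm (v n))).
    by rewrite /q -mulrA ler_wpM2l.
  by rewrite exprS mulrCA ler_wpM2l//; case/andP: q01.
have [F [hF cF]] := complete v _ q q01 hv vq.
have [AF EF] := HR _ hF.
exists (RR F).1, (RR F).2; split=> //.
set u := (RR F).1 in AF EF *; set w := (RR F).2 in AF EF *.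
have hu := memA1 AF; have hw := memA2 AF.
have -> : w - l%:C *: u + psi%:C *: P u = w + psi%:C *: u + K u.
  rewrite /K rmorphD scalerDl opprD [X in _ = _ + X]addrA [RHS]addrA.
  by rewrite (addrAC w (psi%:C *: u)) addrK -!addrA [psi%:C *: P u + _]addrC.
set z := w + psi%:C *: u in EF *; have hz : hmem z by apply/hmemD/hmemZ.
pose U n := \sum_(i < n) (RR (v i)).1; pose V n := \sum_(i < n) (RR (v i)).2.
pose S n := \sum_(i < n) v i; pose a n := hnorm (F - S n).
have hS n : hmem (S n) by exact: hmem_sum.
have AUV n : A (U n) (V n) 
    by exact: (@symop_sum (fun i => (RR (v i)).1) (fun i => (RR (v i)).2)).
have hU n : hmem (U n) by exact: memA1 (AUV n).
have hV n : hmem (V n) by exact: memA2 (AUV n).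
have K0 : K 0 = 0 by have := KB 0 0; rewrite !subrr.
have KS n : S n.+1 = f - K (U n).
  elim: n => [|n IH].
    by rewrite /S /U big_ord_recr/= !big_ord0 add0r K0 subr0.
  rewrite /S big_ord_recr/= -/(S n.+1) IH /U big_ord_recr/= -/(U n).
  have := KB (U n) (- (RR (v n)).1); rewrite opprK => ->.
  have := KB 0 (RR (v n)).1; rewrite K0 !sub0r => ->.
  by move: (K (U n)) (K (RR (v n)).1) => X Y; rewrite opprK opprD addrA.
have S0 n : hnorm (V n + psi%:C *: U n - S n) = 0.
  elim: n => [|n IH].
    by rewrite /V /U /S !big_ord0 scaler0 subr0 addr0 hnorm0.
  rewrite /V /U /S !big_ord_recr/= -/(V n) -/(U n) -/(S n).
  rewrite scalerDr [X in hnorm (X - _)]addrACA opprD [X in hnorm X]addrACA.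
  have [Auw E] := HR _ (hv n).
  have h1 := memA1 Auw; have h2 := memA2 Auw.
  apply/eqP; rewrite eq_le hnorm_ge0 andbT.
  apply: le_trans (hnorm_triangle _ _) _; last by rewrite IH E addr0.
    by apply: hmemB => //; apply/hmemD/hmemZ.
  by apply: hmemB => //; apply/hmemD/hmemZ.
(* [RR] is a mere choice function, so [u] cannot be compared with [U n] by linearity. The lower
   bound of [A + psi], applied to the difference of the two graph pairs, does it instead. *)
have Ua n : hnorm (u - U n) <= (m + psi)^-1 * a n.
  rewrite mulrC ler_pdivlMr// mulrC.
  apply: le_trans (boundA _ _ (symopB AF (AUV n))) _.
  rewrite /a le_eqVlt; apply/orP; left; apply/eqP.
  apply: hnorm_eq0_congr.
  - by apply/hmemD/hmemZ; apply: hmemB.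
  - exact: hmemB.
  have -> : w - V n + psi%:C *: (u - U n) - (F - S n) =
            z - F - (V n + psi%:C *: U n - S n).
    rewrite scalerBr addrACA -opprD -/z.
    set X := V n + _; rewrite [in LHS]opprB [in RHS]opprB [LHS]addrACA [RHS]addrACA.
    by congr (_ + _); exact: addrC.
  apply/eqP; rewrite eq_le hnorm_ge0 andbT.
  have hVU : hmem (V n + psi%:C *: U n - S n) by apply: hmemB => //; apply/hmemD/hmemZ.
  apply: le_trans (hnorm_triangle (hmemB hz hF) (hmemN hVU)) _.
  by rewrite EF hnormN// S0 addr0.
(* The left side does not depend on [n], so the limit of the right side forces it to be 0. The index
   [n.+1] appears because [KS] relates [U n] to the next partial sum of [v]. *)
have ub n : hnorm (z + K u - f) <= a n.+1 + q * a n.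
  have -> : z + K u - f = z - F + (F - S n.+1 + K (u - U n)).
    rewrite KB KS opprB; move: (K u) (K (U n)) (z) => X Y Z.
    by rewrite -[F + _ + _]addrA subrKA [Y - f + _]addrC subrKA addrA.
  apply: le_trans (hnorm_triangle (hmemB hz hF) _) _.
    by apply: hmemD; [exact: hmemB|exact/hK/hmemB].
  rewrite EF add0r.
  apply: le_trans (hnorm_triangle (hmemB hF (hS _)) _) _; first exact/hK/hmemB.
  rewrite lerD2l (le_trans (normK _ (hmemB hu (hU n))))// /q -mulrA ler_wpM2l//.
have c0 : (fun n => a n.+1 + q * a n) @ \oo --> (0 : R).
  rewrite -[X in _ --> X](addr0 0) -[X in _ --> 0 + X](mulr0 q).
  apply: cvgD; last exact: cvgMr.
  by move: cF; rewrite -(cvg_shiftS a).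
apply/eqP; rewrite eq_le hnorm_ge0 andbT -(cvg_lim _ c0)//.
by apply: limr_ge; [exact: cvgP c0|exact: nearW].
Qed.

End Perturbation.
End SymmetricOperator.
End SemiInnerProduct.

(** * The space L2 of the torus *)

Section Lfun2.
Context d (T : measurableType d) (R : realType).
Variable mu : {measure set T -> \bar R}.

Lemma Lfun2P (f : T -> R) : f \in Lfun mu 2%:E <->
  measurable_fun setT f /\ mu.-integrable setT (EFin \o (fun x => f x ^+ 2)).
Proof.
split=> [lf|[mf /integrableP[_ intf]]].
  split; last exact: Lfun2_integrable_sqr.
  by move: lf; rewrite inE => /andP[/[!inE]].
rewrite inE; apply/andP; split; rewrite inE//=.
rewrite /finite_norm unlock /Lnorm poweR_lty//.
apply: le_lt_trans intf; rewrite le_eqVlt; apply/orP; left; apply/eqP.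
by apply: eq_integral => x _ /=; rewrite powR_mulrn// normrX.
Qed.

Lemma Lfun2_measurable (f : T -> R) : f \in Lfun mu 2%:E -> measurable_fun setT f.
Proof. by case/Lfun2P. Qed.

Lemma Lfun2_dominated (f g : T -> R) : measurable_fun setT g ->
  (forall x, `|g x| <= `|f x|) -> f \in Lfun mu 2%:E -> g \in Lfun mu 2%:E.
Proof.
move=> mg gf /Lfun2P[mf intf]; apply/Lfun2P; split=> //.
apply: le_integrable intf => //.
  by apply/measurable_EFinP; exact: measurable_funX.
move=> x _ /=; rewrite lee_fin !normrX.
by apply: lerXn2r; rewrite ?nnegrE.
Qed.

Lemma Lfun2_mul_integrable (f g : T -> R) : f \in Lfun mu 2%:E ->
  g \in Lfun mu 2%:E -> mu.-integrable setT (EFin \o (fun x => f x * g x)).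
Proof. by move=> lf lg; apply/Lfun1_integrable; exact: Lfun2_mul_Lfun1. Qed.

Lemma Lfun2_lin (a : R) (f g : T -> R) : f \in Lfun mu 2%:E ->
  g \in Lfun mu 2%:E -> (fun x => a * f x + g x) \in Lfun mu 2%:E.
Proof.
move=> lf lg.
have laf : (fun x => a * f x) \in Lfun mu 2%:E.
  rewrite (_ : (fun _ => _) = a \o* f); first by apply: Lfun_scale; rewrite ?ler1n.
  by apply/funext => x; rewrite /= mulrC.
have [_ lD] := Lfun_addr_closed mu (lee1n 2).
exact: lD _ _ laf lg.
Qed.

Lemma Lfun2_0 : (fun=> 0) \in Lfun mu 2%:E :> bool.
Proof. by have [l0 _] := Lfun_addr_closed mu (lee1n 2); exact: l0. Qed.

End Lfun2.

Section L2.
Context {R : realType}.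
Local Notation plane := (measurableTypeR R * measurableTypeR R)%type.
Local Notation mu := (@torus_measure R).
Local Notation Re := complex.Re.
Local Notation Im := complex.Im.
Implicit Types u v w : hsort (@L2 R).

Lemma torus_measureT : mu setT = 1%E.
Proof.
rewrite /= /mrestr setTI /cell /lebesgue2 product_measure1E//=.
  by rewrite !lebesgue_measure_itv/= lte01 oppr0 adde0 mule1.
Qed.

Lemma L2_addE u v x : (u + v) x = u x + v x. Proof. by []. Qed.
Lemma L2_oppE u x : (- u) x = - u x. Proof. by []. Qed.
Lemma L2_scaleE z u x : (z *: u) x = z * u x. Proof. by []. Qed.
Definition L2E := (L2_addE, L2_oppE, L2_scaleE).

Lemma Re_rdotE (z z' : R[i]) : Re (z * z'^*%C) = Re z * Re z' + Im z * Im z'.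
Proof. by case: z z' => [a b] [c d] /=; rewrite mulrN opprK. Qed.

Lemma Im_rdotE (z z' : R[i]) : Im (z * z'^*%C) = Im z * Re z' - Re z * Im z'.
Proof. by case: z z' => [a b] [c d] /=; rewrite mulrN addrC. Qed.

Lemma Re_scale (a : R) (z : R[i]) : Re (a%:C * z) = a * Re z.
Proof. by case: z => [c d] /=; rewrite mul0r subr0. Qed.

Lemma Im_scale (a : R) (z : R[i]) : Im (a%:C * z) = a * Im z.
Proof. by case: z => [c d] /=; rewrite mul0r addr0. Qed.

Lemma rdot_L2E u v :
  rdot u v = \int[mu]_x (Re (u x) * Re (v x) + Im (u x) * Im (v x)).
Proof. by apply: eq_Rintegral => x _; rewrite Re_rdotE. Qed.

Lemma integrable_rdot u v : hmem u -> hmem v ->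
  mu.-integrable setT (EFin \o (fun x => Re (u x) * Re (v x) + Im (u x) * Im (v x))).
Proof.
move=> [ru iu] [rv iv].
have h1 := Lfun2_mul_integrable ru rv; have h2 := Lfun2_mul_integrable iu iv.
exact: (integrableD measurableT h1 h2).
Qed.

Lemma hmem_lin (z : R[i]) u v : hmem u -> hmem v -> @hmem R L2 (z *: u + v).
Proof.
case: z => a b [ru iu] [rv iv]; split.
  rewrite (_ : (fun _ => _) = fun x => a * Re (u x) + (- b * Im (u x) + Re (v x))).
    by do 2!apply: Lfun2_lin => //.
  by apply/funext => x; rewrite !L2E; case: (u x) (v x) => [p q] [r s] /=; ring.
rewrite (_ : (fun _ => _) = fun x => a * Im (u x) + (b * Re (u x) + Im (v x))).
  by do 2!apply: Lfun2_lin => //.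
by apply/funext => x; rewrite !L2E; case: (u x) (v x) => [p q] [r s] /=; ring.
Qed.

Lemma semi_inner_L2 : semi_inner (@L2 R).
Proof.
split.
- by split; exact: Lfun2_0.
- by move=> a u v; exact: hmem_lin.
- by move=> u v hu hv; rewrite !rdot_L2E; apply: eq_Rintegral => x _; ring.
- move=> a u v w hu hv hw; rewrite !rdot_L2E.
  rewrite -RintegralZl//; last exact: integrable_rdot.
  rewrite -RintegralD//; last 2 first.
  - by have := integrableZl measurableT a (integrable_rdot hu hw).
  - exact: integrable_rdot.
  apply: eq_Rintegral => x _.
  by rewrite !L2E; case: (u x) (v x) (w x) => [? ?] [? ?] [? ?] /=; ring.
- move=> u hu; rewrite rdot_L2E; apply: Rintegral_ge0 => x _.
  by rewrite -!expr2 addr_ge0 ?sqr_ge0.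
Qed.

Lemma hmem_measurable_Re u : hmem u -> measurable_fun setT (fun x => Re (u x)).
Proof. by case=> + _ => /Lfun2_measurable. Qed.
Lemma hmem_measurable_Im u : hmem u -> measurable_fun setT (fun x => Im (u x)).
Proof. by case=> _ /Lfun2_measurable. Qed.

Lemma measurable_rdot u v : hmem u -> hmem v ->
  measurable_fun setT (fun x => Re (u x) * Re (v x) + Im (u x) * Im (v x)).
Proof.
move=> hu hv; apply: measurable_funD; apply: measurable_funM;
  by [exact: hmem_measurable_Re|exact: hmem_measurable_Im].
Qed.

Lemma Rintegral_ae_eq (f g : plane -> R) : measurable_fun setT f ->
  measurable_fun setT g -> f = g %[ae mu] -> \int[mu]_x f x = \int[mu]_x g x.
Proof.
move=> mf mg fg; congr fine; apply: ae_eq_integral => //.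
- exact/measurable_EFinP.
- exact/measurable_EFinP.
- by apply: filterS fg => x /= + _ => ->.
Qed.

(** The tool for changing representatives. The hypothesis compares products rather than factors, so
    that a real weight or an indicator may also move from one argument to the other. *)
Lemma hdot_aeE u v u' v' : hmem u -> hmem v -> hmem u' -> hmem v' ->
  (fun x => u x * (v x)^*%C) = (fun x => u' x * (v' x)^*%C) %[ae mu] ->
  hdot u v = hdot u' v'.
Proof.
move=> hu hv hu' hv' E.
have m1 := hmem_measurable_Re hu; have m2 := hmem_measurable_Im hu.
have m3 := hmem_measurable_Re hv; have m4 := hmem_measurable_Im hv.
have m5 := hmem_measurable_Re hu'; have m6 := hmem_measurable_Im hu'.
have m7 := hmem_measurable_Re hv'; have m8 := hmem_measurable_Im hv'.
rewrite /= /l2dot /cintegral; congr Complex; apply: Rintegral_ae_eq.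
- under eq_fun do rewrite Re_rdotE.
  by apply: measurable_funD; exact: measurable_funM.
- under eq_fun do rewrite Re_rdotE.
  by apply: measurable_funD; exact: measurable_funM.
- by apply: filterS E => x /= -> .
- under eq_fun do rewrite Im_rdotE.
  by apply: measurable_funB; exact: measurable_funM.
- under eq_fun do rewrite Im_rdotE.
  by apply: measurable_funB; exact: measurable_funM.
- by apply: filterS E => x /= -> .
Qed.

Lemma hnorm_ae0 u : hmem u -> u = (fun=> 0) %[ae mu] -> hnorm u = 0.
Proof.
move=> hu u0; have h0 := hmem0 semi_inner_L2.
rewrite /hnorm (@hdot_aeE u u 0 0)//.
  by have := hnorm0 semi_inner_L2.
by apply: filterS u0 => x /= + _ => ->//; rewrite !mul0r.
Qed.

Lemma hnorm_eq0_ae u : hmem u -> hnorm u = 0 -> u = (fun=> 0) %[ae mu].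
Proof.
move=> hu u0.
have H : (\int[mu]_x `|(Re (u x) * Re (u x) + Im (u x) * Im (u x))%:E| = 0)%E.
  have : rdot u u = 0 by rewrite -(sqr_hnorm semi_inner_L2 hu) u0 expr0n.
  rewrite rdot_L2E => I0.
  transitivity (\int[mu]_x ((Re (u x) * Re (u x) + Im (u x) * Im (u x))%:E))%E.
    by apply: eq_integral => x _; rewrite gee0_abs// lee_fin -!expr2 addr_ge0 ?sqr_ge0.
  rewrite -(fineK (integrable_fin_num _ (integrable_rdot hu hu)))//.
  by rewrite -/(Rintegral _ _ _) I0.
have /ae_eq_integral_abs-/(_ measurableT) := H.
have /measurable_int mR := integrable_rdot hu hu.
move=> /(_ mR); apply: filterS => x /= /(_ I) [].
case: (u x) => [a b] /= /eqP; rewrite -!expr2 paddr_eq0 ?sqr_ge0// !sqrf_eq0.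
by move=> /andP[/eqP -> /eqP ->].
Qed.

Lemma hnormB_aeE u v : hmem u -> hmem v -> u = v %[ae mu] -> hnorm (u - v) = 0.
Proof.
move=> hu hv uv; apply: hnorm_ae0; first exact: (hmemB semi_inner_L2).
by apply: filterS uv => x /= uvx _; rewrite !L2E uvx// subrr.
Qed.

Lemma hnormB_eq0_ae u v : hmem u -> hmem v -> hnorm (u - v) = 0 -> u = v %[ae mu].
Proof.
move=> hu hv /(hnorm_eq0_ae (hmemB semi_inner_L2 hu hv)).
by apply: filterS => x /= H _; apply/eqP; rewrite -subr_eq0; apply/eqP/H.
Qed.

Lemma hnorm_tail (f : nat -> hsort (@L2 R)) (c q : R) : 0 <= q < 1 ->
  (forall n, hmem (f n)) -> (forall n, hnorm (f n) <= c * q ^+ n) ->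
  forall N k, hnorm (\sum_(i < N + k) f i - \sum_(i < N) f i) <= c * q ^+ N / (1 - q).
Proof.
move=> /andP[q0 q1] hf fb N k.
have HL := semi_inner_L2.
have c0 : 0 <= c by have := le_trans (hnorm_ge0 _) (fb 0%N); rewrite expr0 mulr1.
have q10 : 0 < 1 - q by rewrite subr_gt0.
have hS n : @hmem R L2 (\sum_(i < n) f i) by exact: hmem_sum.
(* Keeping the factor [1 - q ^+ k] of the finite geometric sum lets the induction on [k] close with
   equality. *)
suff : hnorm (\sum_(i < N + k) f i - \sum_(i < N) f i) <=
       c * q ^+ N * (1 - q ^+ k) / (1 - q).
  move/le_trans; apply; rewrite ler_pM2r ?invr_gt0//.
  by rewrite ler_piMr ?mulr_ge0 ?exprn_ge0// gerBl exprn_ge0.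
elim: k => [|k IH].
  by rewrite addn0 subrr hnorm0// expr0 subrr mulr0 mul0r.
rewrite addnS big_ord_recr/= addrAC.
apply: le_trans (hnorm_triangle HL (hmemB HL (hS _) (hS _)) (hf _)) _.
apply: le_trans (lerD IH (fb _)) _.
rewrite le_eqVlt; apply/orP; left; apply/eqP.
by rewrite exprD exprS; field; rewrite gt_eqF.
Qed.

(** Take for [F] the pointwise limit of the partial sums. Fatou's lemma, applied to |S (N + k) - S
    N|^2 as [k] grows, transfers the tail estimate to [F - S N]. *)
Lemma geometric_complete_pointwise (f : nat -> hsort (@L2 R)) (c q : R) : 0 <= q < 1 ->
  (forall n, hmem (f n)) -> (forall n, hnorm (f n) <= c * q ^+ n) ->
  (forall x, cvgn (fun n => Re ((\sum_(i < n) f i) x))) ->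
  (forall x, cvgn (fun n => Im ((\sum_(i < n) f i) x))) ->
  exists F, hmem F /\ (fun n => hnorm (F - \sum_(i < n) f i)) @ \oo --> (0 : R).
Proof.
move=> q01 hf fb cRe cIm.
have /andP[q0 q1] := q01.
have HL := semi_inner_L2.
pose S n := \sum_(i < n) f i.
have hS n : @hmem R L2 (S n) by exact: hmem_sum.
have tail N k : hnorm (S (N + k)%N - S N) <= c * q ^+ N / (1 - q) by exact: hnorm_tail.
pose Fr x := limn (fun n => Re (S n x)); pose Fi x := limn (fun n => Im (S n x)).
pose F : hsort (@L2 R) := fun x => Fr x +i* Fi x.
have mFr : measurable_fun setT Fr.
  apply: measurable_fun_cvg (fun x _ => cRe x) => m.
  exact: hmem_measurable_Re (hS m).
have mFi : measurable_fun setT Fi.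
  apply: measurable_fun_cvg (fun x _ => cIm x) => m.
  exact: hmem_measurable_Im (hS m).
pose sq (u : hsort (@L2 R)) x := Re (u x) * Re (u x) + Im (u x) * Im (u x).
have sq0 u x : 0 <= sq u x by rewrite /sq -!expr2 addr_ge0 ?sqr_ge0.
have bnd N : (\int[mu]_x (sq (F - S N) x)%:E <= ((c * q ^+ N / (1 - q)) ^+ 2)%:E)%E.
  pose h k x := (sq (S (N + k)%N - S N) x)%:E.
  have hD k : hmem (S (N + k)%N - S N) by exact: (hmemB HL).
  have hk k : (\int[mu]_x h k x <= ((c * q ^+ N / (1 - q)) ^+ 2)%:E)%E.
    have /integrable_fin_num : mu.-integrable setT (h k).
      exact: integrable_rdot (hD k) (hD k).
    move=> /(_ measurableT) /fineK <-.
    rewrite -/(Rintegral _ _ _) lee_fin -rdot_L2E -(sqr_hnorm HL)//.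
    by rewrite lerXn2r ?nnegrE ?hnorm_ge0// (le_trans (hnorm_ge0 _) (tail N k)).
  have hlim x : limn_einf (h^~ x) = (sq (F - S N) x)%:E.
    have cr : (fun k => Re (S (N + k)%N x)) @ \oo --> Fr x.
      exact: cvg_comp (cvg_addnl N) (cRe x).
    have ci : (fun k => Im (S (N + k)%N x)) @ \oo --> Fi x.
      exact: cvg_comp (cvg_addnl N) (cIm x).
    apply: (cvg_limn_einf_sup _).1; apply: cvg_EFin; first exact: nearW.
    have ReB (u : hsort L2) : Re ((u - S N) x) = Re (u x) - Re (S N x).
      by rewrite !L2E; case: (u x) (S N x) => [? ?] [? ?].
    have ImB (u : hsort L2) : Im ((u - S N) x) = Im (u x) - Im (S N x).
      by rewrite !L2E; case: (u x) (S N x) => [? ?] [? ?].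
    rewrite /sq ReB ImB (_ : fine \o _ = fun k =>
      (Re (S (N + k)%N x) - Re (S N x)) * (Re (S (N + k)%N x) - Re (S N x)) +
      (Im (S (N + k)%N x) - Im (S N x)) * (Im (S (N + k)%N x) - Im (S N x))); last first.
      by apply/funext => k; rewrite /h /= /sq ReB ImB.
    apply: cvgD; apply: cvgM; apply: cvgB => //; exact: cvg_cst.
  under eq_integral do rewrite -hlim.
  apply: le_trans (fatou mu measurableT _ _) _.
  - by move=> k; exact: measurable_int (integrable_rdot (hD k) (hD k)).
  - by move=> k x _; rewrite lee_fin.
  rewrite limn_einf_lim; apply: lime_le; first exact: is_cvg_einfs.
  apply: nearW => k; apply: le_trans (hk k).
  by apply: ereal_inf_lbound; exists k => /=.
(* The case [N = 0] of [bnd], where the partial sum is 0, shows that [F] is square integrable. *)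
have hF : hmem F.
  have mF : measurable_fun setT (sq F).
    by apply: measurable_funD; exact: measurable_funM.
  have iF : mu.-integrable setT (EFin \o sq F).
    apply/integrableP; split; first exact/measurable_EFinP.
    under eq_integral do rewrite /= ger0_norm//.
    have := bnd 0%N; rewrite /S big_ord0 subr0 => /le_lt_trans; apply.
    exact: ltry.
  split; apply/Lfun2P; split=> //; apply: le_integrable iF => //;
    try (apply/measurable_EFinP; exact: measurable_funX);
    by move=> x _ /=; rewrite lee_fin !ger0_norm ?sqr_ge0// /sq -!expr2 ?lerDl ?lerDr sqr_ge0.
exists F; split=> //.
have bN N : 0 <= hnorm (F - S N) <= c / (1 - q) * q ^+ N.
  rewrite hnorm_ge0/=.
  have B0 : 0 <= c * q ^+ N / (1 - q) by exact: le_trans (hnorm_ge0 _) (tail N 0%N).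
  rewrite mulrAC -(@ler_pXn2r _ 2)// ?nnegrE ?hnorm_ge0//.
  have hFN : hmem (F - S N) by exact: (hmemB HL).
  rewrite (sqr_hnorm HL)// rdot_L2E -lee_fin fineK ?bnd//.
  exact: integrable_fin_num (integrable_rdot hFN hFN).
apply: (squeeze_cvgr (f := fun=> 0) (h := fun N => c / (1 - q) * q ^+ N));
  [exact: nearW|exact: cvg_cst|].
rewrite -[X in _ --> X](mulr0 (c / (1 - q))); apply: cvgMr.
by apply: cvg_expr; rewrite ger0_norm.
Qed.

(** The torus has finite measure, so Cauchy-Schwarz against a constant function bounds the integrals
    of the terms by a geometric sequence. Integrating termwise, the sum is integrable, hence finite
    almost everywhere. *)
Lemma geometric_ae_summable (f : nat -> hsort (@L2 R)) (c q : R) : 0 <= q < 1 ->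
  (forall n, hmem (f n)) -> (forall n, hnorm (f n) <= c * q ^+ n) ->
  {ae mu, forall x, (\sum_(n <oo) (`|Re (f n x)| + `|Im (f n x)|)%:E < +oo)%E}.
Proof.
move=> q01 hf fb.
have /andP[q0 q1] := q01.
have HL := semi_inner_L2.
have c0 : 0 <= c by have := le_trans (hnorm_ge0 _) (fb 0%N); rewrite expr0 mulr1.
(* The real part of the product of [af n] with 1 + i is the sum |Re| + |Im|. *)
pose one : hsort (@L2 R) := fun=> 1 +i* 1.
pose af n : hsort (@L2 R) := fun x => `|Re (f n x)| +i* `|Im (f n x)|.
have int1 : mu.-integrable setT (EFin \o (fun=> 1 ^+ 2)).
  apply: measurable_bounded_integrable => //; last exact: (@bounded_cst _ R).
  by rewrite torus_measureT ltry.
have hone : hmem one by split; apply/Lfun2P; split.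
have haf n : hmem (af n).
  have [h1 h2] := hf n; split.
    apply: Lfun2_dominated h1 => /=; last by move=> x; rewrite normr_id.
    by apply: measurableT_comp => //; exact: hmem_measurable_Re (hf n).
  apply: Lfun2_dominated h2 => /=; last by move=> x; rewrite normr_id.
  by apply: measurableT_comp => //; exact: hmem_measurable_Im (hf n).
have naf n : hnorm (af n) = hnorm (f n).
  rewrite /hnorm -/(rdot _ _) -[in RHS]/(rdot _ _) !rdot_L2E; congr Num.sqrt.
  apply: eq_Rintegral => x _ /=.
  by rewrite -!expr2 !real_normK ?num_real.
pose g n x := (`|Re (f n x)| + `|Im (f n x)|)%:E.
have g0 n x : (0 <= g n x)%E by rewrite lee_fin addr_ge0.
have mg n : measurable_fun setT (g n).
  apply/measurable_EFinP/measurable_funD.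
    exact: hmem_measurable_Re (haf n).
  exact: hmem_measurable_Im (haf n).
have Ig n : (\int[mu]_x g n x <= (c * hnorm one * q ^+ n)%:E)%E.
  have E : g n = EFin \o (fun x => Re (af n x) * Re (one x) + Im (af n x) * Im (one x)).
    by apply/funext => x; rewrite /g /= !mulr1.
  rewrite E -(fineK (integrable_fin_num _ (integrable_rdot (haf n) hone)))//.
  rewrite -/(Rintegral _ _ _) lee_fin -rdot_L2E.
  apply: le_trans (ler_norm _) _.
  apply: le_trans (cauchy_schwarz HL (haf n) hone) _.
  by rewrite naf mulrAC ler_wpM2r// hnorm_ge0.
have mG : measurable_fun setT (fun x => \sum_(n <oo) g n x)%E.
  have := @ge0_emeasurable_sum _ _ _ setT g xpredT (fun k x _ _ => g0 k x) (fun k _ => mg k).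
  by [].
have G0 x : (0 <= \sum_(n <oo) g n x)%E by apply: nneseries_ge0.
have iG : mu.-integrable setT (fun x => \sum_(n <oo) g n x)%E.
  apply/integrableP; split=> //.
  under eq_integral do rewrite gee0_abs//.
  rewrite integral_nneseries//.
  apply: (@le_lt_trans _ _ ((c * hnorm one / (1 - q))%:E)%E); last exact: ltry.
  apply: lime_le; first by apply: is_cvg_nneseries => n _ _; exact: integral_ge0.
  apply: nearW => n.
  apply: (@le_trans _ _ (\sum_(0 <= i < n) (c * hnorm one * q ^+ i)%:E)%E).
    by apply: lee_sum => i _; exact: Ig.
  rewrite sumEFin lee_fin -mulr_sumr ler_wpM2l ?mulr_ge0 ?hnorm_ge0//.
  have q10 : 0 < 1 - q by rewrite subr_gt0.
  rewrite -[leRHS]mul1r ler_pdivlMr// big_mkord.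
  have -> : (\sum_(i < n) q ^+ i) * (1 - q) = 1 - q ^+ n.
    by have := subrX1 q n => E; rewrite -[RHS]opprB E -mulNr opprB mulrC.
  by rewrite gerBl exprn_ge0.
have := integrable_ae measurableT iG.
apply: filterS => x /(_ I).
by rewrite ge0_fin_numE.
Qed.

Lemma geometric_complete_L2 : geometric_complete (@L2 R).
Proof.
move=> f c q q01 hf fb.
have HL := semi_inner_L2.
pose G x := (\sum_(n <oo) (`|Re (f n x)| + `|Im (f n x)|)%:E)%E.
pose E : set plane := [set x | (G x < +oo)%E].
have mE : measurable E.
  rewrite -[E]setTI; apply: emeasurable_fun_infty_o => //.
  apply: (@ge0_emeasurable_sum _ _ _ setT _ xpredT).
    by move=> k x _ _; rewrite lee_fin addr_ge0.
  move=> k _; apply/measurable_EFinP/measurable_funD; apply: measurableT_comp => //.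
    exact: hmem_measurable_Re (hf k).
  exact: hmem_measurable_Im (hf k).
(* [geometric_complete_pointwise] asks for convergence at every point. Cutting the terms off outside
   the set [E] of absolute summability achieves this and changes each term only on a null set. *)
pose f' n : hsort (@L2 R) := fun x => (\1_E x)%:C * f n x.
have Ef' n x : f' n x = if x \in E then f n x else 0.
  by rewrite /f' indicE; case: (x \in E); rewrite ?mul1r ?mul0r.
have hf' n : hmem (f' n).
  have [h1 h2] := hf n; split.
    apply: Lfun2_dominated h1.
      under eq_fun do rewrite /f' Re_scale.
      apply: measurable_funM; last exact: hmem_measurable_Re (hf n).
      exact: measurable_indic.
    by move=> x; rewrite Ef'; case: ifP => //= _; rewrite normr0.
  apply: Lfun2_dominated h2.
    under eq_fun do rewrite /f' Im_scale.
    apply: measurable_funM; last exact: hmem_measurable_Im (hf n).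
    exact: measurable_indic.
  by move=> x; rewrite Ef'; case: ifP => //= _; rewrite normr0.
have ff' n : f' n = f n %[ae mu].
  apply: filterS (geometric_ae_summable q01 hf fb) => x /= Gx _.
  by rewrite Ef' mem_set.
have nf' n : hnorm (f' n) = hnorm (f n).
  by apply: (hnorm_eq0_congr HL) => //; exact: hnormB_aeE.
have fb' n : hnorm (f' n) <= c * q ^+ n by rewrite nf'.
have sumRe (u : nat -> hsort (@L2 R)) n x : Re ((\sum_(i < n) u i) x) = \sum_(i < n) Re (u i x).
  elim: n => [|n IH]; first by rewrite !big_ord0.
  by rewrite !big_ord_recr/= -IH !L2E; case: (_ x) (u n x) => [? ?] [? ?].
have sumIm (u : nat -> hsort (@L2 R)) n x : Im ((\sum_(i < n) u i) x) = \sum_(i < n) Im (u i x).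
  elim: n => [|n IH]; first by rewrite !big_ord0.
  by rewrite !big_ord_recr/= -IH !L2E; case: (_ x) (u n x) => [? ?] [? ?].
have cvgE (a : nat -> R) x : (forall n, `|a n| <= `|Re (f n x)| + `|Im (f n x)|) ->
    E x -> cvgn (fun n => \sum_(i < n) a i).
  move=> ab Ex; under eq_fun do rewrite -(big_mkord xpredT).
  apply: (@normed_cvg _ R a); apply: nondecreasing_is_cvgn.
    by apply: nondecreasing_series => n *; exact: normr_ge0.
  exists (fine (G x)) => _ [n _ <-].
  have G0 : (0 <= G x)%E by apply: nneseries_ge0 => k _ _; rewrite lee_fin addr_ge0.
  rewrite -lee_fin fineK ?ge0_fin_numE//.
  apply: le_trans (nneseries_lim_ge n (P := xpredT) _); last first.
    by move=> k _ _; rewrite lee_fin addr_ge0.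
  by rewrite sumEFin lee_fin; apply: ler_sum => i _; exact: ab.
have [x|x|F [hF cF]] := geometric_complete_pointwise q01 hf' fb'.
- under eq_fun do rewrite sumRe.
  have [Ex|nEx] := boolP (x \in E).
    apply: (cvgE (fun i => Re (f' i x)) x) => [n|]; last exact: set_mem.
    by rewrite Ef' Ex lerDl.
  rewrite (_ : (fun _ => _) = fun=> 0); first exact: is_cvg_cst.
  by apply/funext => n; rewrite big1// => i _; rewrite Ef' (negPf nEx).
- under eq_fun do rewrite sumIm.
  have [Ex|nEx] := boolP (x \in E).
    apply: (cvgE (fun i => Im (f' i x)) x) => [n|]; last exact: set_mem.
    by rewrite Ef' Ex lerDr.
  rewrite (_ : (fun _ => _) = fun=> 0); first exact: is_cvg_cst.
  by apply/funext => n; rewrite big1// => i _; rewrite Ef' (negPf nEx).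
exists F; split=> //.
suff -> : (fun n => hnorm (F - \sum_(i < n) f i)) = (fun n => hnorm (F - \sum_(i < n) f' i)) by [].
apply/funext => n; apply: (hnorm_eq0_congr HL).
- by apply: (hmemB HL) => //; exact: hmem_sum.
- by apply: (hmemB HL) => //; exact: hmem_sum.
apply: hnormB_aeE.
- by apply: (hmemB HL) => //; exact: hmem_sum.
- by apply: (hmemB HL) => //; exact: hmem_sum.
elim: n => [|n IH]; first by rewrite !big_ord0; exact: filterE.
apply: filterS2 IH (ff' n) => x /= IHx fx _.
move: (IHx I) => {IHx}; rewrite !big_ord_recr/= !L2E (fx I) => /(congr1 (fun z => z - f n x)).
by rewrite !opprD !addrA.
Qed.

End L2.

(** * Calculus of smooth functions on the torus *)

(** The restricted measure gives the complement of [D] measure zero and agrees with [m] on the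
    measurable subsets of [D]. *)
Lemma integral_mrestr d (T : measurableType d) (R : realType)
    (m : {measure set T -> \bar R}) (D : set T) (mD : measurable D) (f : T -> \bar R) :
  (mrestr m mD).-integrable setT f ->
  (\int[mrestr m mD]_x f x = \int[m]_(x in D) f x)%E.
Proof.
move=> intf.
have mC : measurable (~` D) by exact: measurableC.
have z : mrestr m mD (~` D) = 0%E by rewrite /mrestr setICl measure0.
rewrite (negligible_integral mC measurableT intf z) setTD setCK.
apply: eq_measure_integral => A mA AD.
by rewrite /= /mrestr setIidl.
Qed.

Section TorusCalculus.
Context {R : realType}.
Local Notation plane := (measurableTypeR R * measurableTypeR R)%type.
Local Notation mu := (@torus_measure R).
Local Notation Re := complex.Re.
Local Notation Im := complex.Im.
Local Notation C := (R[i]^o).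

(** The plane carries the product sigma-algebra, so an open set is written as a countable union of
    open squares with rational centre and radius. *)
Lemma measurable_open_plane (U : set plane) : open U -> measurable U.
Proof.
move=> oU.
pose box (p : rat * rat * rat) : set plane :=
  `]ratr p.1.1 - ratr p.2, ratr p.1.1 + ratr p.2[ `*`
  `]ratr p.1.2 - ratr p.2, ratr p.1.2 + ratr p.2[.
pose F p := if `[< box p `<=` U >] then box p else set0.
have -> : U = \bigcup_p F p.
  apply/seteqP; split=> [[x y] Uxy|xy [p _]]; last first.
    by rewrite /F; case: asboolP => // pU; exact: pU.
  have /nbhs_ballP[e /= e0 eU] := oU _ Uxy.
  (* A square of radius below [e / 2] that contains the point lies in the ball of radius [e] around
     it. *)
  have [r] := @rat_in_itvoo R 0 (e / 2) (divr_gt0 e0 (ltr0n _ 2)).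
  rewrite in_itv/= => /andP[r0 re].
  have [p] := @rat_in_itvoo R (x - ratr r) (x + ratr r) ltac:(lra).
  rewrite in_itv/= => /andP[p1 p2].
  have [q] := @rat_in_itvoo R (y - ratr r) (y + ratr r) ltac:(lra).
  rewrite in_itv/= => /andP[q1 q2].
  exists (p, q, r) => //; rewrite /F; case: asboolP => [_|]; last first.
    case=> -[x' y'] [/=]; rewrite !in_itv/= => /andP[a1 a2] /andP[b1 b2].
    apply: eU; split=> /=; rewrite /ball/= ltr_norml; apply/andP; split; lra.
  by split; rewrite /= in_itv/=; apply/andP; split; lra.
apply: countable_bigcupT_measurable; first exact: countableP.
move=> p; rewrite /F; case: asboolP => // _.
by apply: measurableX; exact: measurable_itv.
Qed.

Lemma continuous_measurable_plane (f : plane -> R) : continuous f ->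
  measurable_fun setT f.
Proof.
move=> /continuousP cf; apply: (measurability _ (RGenOInfty.measurableE R)).
move=> _ [_ [a ->] <-]; rewrite setTI.
by apply: measurable_open_plane; apply: cf; exact: rray_open.
Qed.

Lemma continuous_bounded_cell (f : plane -> R) : continuous f ->
  exists2 M : R, 0 <= M & forall x, (`[0, 1] `*` `[0, 1]) x -> `|f x| <= M.
Proof.
move=> cf.
have cK : compact (`[0, 1] `*` `[0, 1] : set plane).
  by apply: compact_setX; exact: segment_compact.
have := continuous_compact (continuous_subspaceT cf) cK.
move=> /compact_bounded[N [_ Nf]].
exists (`|N| + 1) => [|x Kx]; first by rewrite addr_ge0.
by apply: Nf => /=; [rewrite (le_lt_trans (ler_norm N))// ltrDl|exists x].
Qed.

Definition periodic (T : Type) (f : plane -> T) := forall (x : plane) (m n : int),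
  f ((x.1 : R) + m%:~R, (x.2 : R) + n%:~R) = f x.

Lemma periodic_bounded (f : plane -> R) : continuous f -> periodic f ->
  exists2 M : R, 0 <= M & forall x, `|f x| <= M.
Proof.
move=> cf pf; have [M M0 fM] := continuous_bounded_cell cf.
exists M => // -[x y].
rewrite -(pf (x, y) (- Num.floor (x : R)) (- Num.floor (y : R)))/=.
apply: fM; rewrite !rmorphN.
have := floor_itv (x : R); have := floor_itv (y : R).
rewrite !rmorphD/= => /andP[a1 a2] /andP[b1 b2].
by split; rewrite /= in_itv/=; apply/andP; split; lra.
Qed.

Lemma continuous_bounded_on (f : plane -> R) (A : set plane) : continuous f ->
  periodic f -> [bounded f x | x in A].
Proof.
move=> cf pf; have [M M0 fM] := periodic_bounded cf pf.
exists M; split; first exact: num_real.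
by move=> N MN x _; apply: le_trans (fM x) (ltW MN).
Qed.

Lemma continuous_torus_integrable (f : plane -> R) : continuous f -> periodic f ->
  mu.-integrable setT (EFin \o f).
Proof.
move=> cf pf; apply: measurable_bounded_integrable => //.
- by rewrite torus_measureT ltry.
- exact: continuous_measurable_plane.
- exact: continuous_bounded_on.
Qed.

Lemma continuous_cell_integrable (f : plane -> R) : continuous f -> periodic f ->
  (@lebesgue2 R).-integrable setT ((EFin \o f) \_ (@cell R)).
Proof.
move=> cf pf; apply/(integrable_mkcond _ (@measurable_cell R)).
apply: measurable_bounded_integrable.
- exact: measurable_cell.
- by have := @torus_measureT R; rewrite /= /mrestr setTI => ->; exact: ltry.
- by apply: measurable_funTS; exact: continuous_measurable_plane.
- exact: continuous_bounded_on.
Qed.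

Lemma torus_integralE (f : plane -> R) : continuous f -> periodic f ->
  \int[mu]_x f x = fine (\int[lebesgue2]_x ((EFin \o f) \_ (@cell R)) x).
Proof.
move=> cf pf; rewrite /Rintegral integral_mrestr; last exact: continuous_torus_integrable.
by rewrite integral_mkcond.
Qed.

Lemma torus_integral_eq0_fst (f : plane -> R) : continuous f -> periodic f ->
  (forall y : R, \int[lebesgue_measure]_(x in `]0%R, 1%R]) (f (x, y))%:E = 0)%E ->
  \int[mu]_x f x = 0.
Proof.
move=> cf pf H; rewrite torus_integralE//.
rewrite -(@integral21_prod_meas1 _ _ _ _ _ lebesgue_measure lebesgue_measure _
  (continuous_cell_integrable cf pf)).
rewrite integral0_eq// => y _; rewrite /fubini_G.
have [y01|ny] := boolP ((y : R) \in `]0, 1]); last first.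
  apply: integral0_eq => x _; rewrite patchE ifF//.
  by apply/negbTE; rewrite notin_setE => -[_ /=]; exact/negP.
rewrite -[RHS](H y) [RHS]integral_mkcond; apply: eq_integral => x _.
by rewrite !patchE; congr (if _ then _ else _); apply/idP/idP;
  rewrite !inE => // -[].
Qed.

Lemma torus_integral_eq0_snd (f : plane -> R) : continuous f -> periodic f ->
  (forall x : R, \int[lebesgue_measure]_(y in `]0%R, 1%R]) (f (x, y))%:E = 0)%E ->
  \int[mu]_x f x = 0.
Proof.
move=> cf pf H; rewrite torus_integralE//.
rewrite -(@integral12_prod_meas1 _ _ _ _ _ lebesgue_measure lebesgue_measure _
  (continuous_cell_integrable cf pf)).
rewrite integral0_eq// => x _; rewrite /fubini_F.
have [x01|nx] := boolP ((x : R) \in `]0, 1]); last first.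
  apply: integral0_eq => y _; rewrite patchE ifF//.
  by apply/negbTE; rewrite notin_setE => -[/= + _]; exact/negP.
rewrite -[RHS](H x) [RHS]integral_mkcond; apply: eq_integral => y _.
by rewrite !patchE; congr (if _ then _ else _); apply/idP/idP;
  rewrite !inE => // -[].
Qed.

(** The fundamental theorem of calculus over a full period: the boundary terms cancel. *)
Lemma integral_derive_unit_itv (f : R -> R) : (forall x, derivable f x 1) ->
  continuous ('D_1 f : R -> R) -> f 1 = f 0 ->
  (\int[lebesgue_measure]_(x in `]0%R, 1%R]) ('D_1 f x)%:E = 0)%E.
Proof.
move=> df cDf f10.
have cf : continuous f.
  by move=> x; apply/differentiable_continuous/derivable1_diffP.
rewrite integral_itv_obnd_cbnd; last first.
  by apply/measurable_EFinP/measurable_funTS; exact: continuous_measurable_fun.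
rewrite (@continuous_FTC2 _ _ f 0 1 ltr01).
- by rewrite f10 subee.
- exact: continuous_subspaceT.
- split=> //.
    exact: cvg_at_right_filter (cf 0).
  exact: cvg_at_left_filter (cf 1).
- by move=> x _; rewrite derive1E.
Qed.

Lemma integral_derive_fst (f : plane -> R) :
  (forall x, derivable f x (1, 0)) -> continuous ('D_(1, 0) f : plane -> R) ->
  periodic f -> periodic ('D_(1, 0) f : plane -> R) ->
  \int[mu]_x ('D_(1, 0) f x) = 0.
Proof.
move=> df cDf pf pDf; apply: torus_integral_eq0_fst => // y.
(* The difference quotients of the slice are literally those of the partial derivative, so
   derivability and values carry over without a chain rule. *)
have DE x : (fun h : R => h^-1 *: (((fun x => f (x, y)) \o shift x) (h *: 1) - f (x, y))) =
  (fun h : R => h^-1 *: ((f \o shift (x, y)) (h *: (1, 0)) - f (x, y))).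
  apply/funext => h; congr (_ *: (f _ - _)).
  by apply/pair_equal_spec; split; rewrite //= scaler0 add0r.
have dfE (x : R) : 'D_1 (fun x : R => f (x, y)) x = 'D_(1, 0) f (x, y).
  by rewrite /derive DE.
under eq_integral do rewrite -dfE.
apply: integral_derive_unit_itv.
- by move=> x; rewrite /derivable DE; exact: df.
- have -> : ('D_1 (fun x : R => f (x, y)) : R -> R) =
      ('D_(1, 0) f : plane -> R) \o (fun x : R => (x, y)) by exact/funext.
  move=> x; apply: continuous_comp; last exact: cDf.
  by apply: differentiable_continuous; exact: differentiable_pair.
- by have := pf (0, y) 1 0; rewrite /= add0r addr0.
Qed.

Lemma integral_derive_snd (f : plane -> R) :
  (forall x, derivable f x (0, 1)) -> continuous ('D_(0, 1) f : plane -> R) ->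
  periodic f -> periodic ('D_(0, 1) f : plane -> R) ->
  \int[mu]_x ('D_(0, 1) f x) = 0.
Proof.
move=> df cDf pf pDf; apply: torus_integral_eq0_snd => // x.
have DE y : (fun h : R => h^-1 *: (((fun y => f (x, y)) \o shift y) (h *: 1) - f (x, y))) =
  (fun h : R => h^-1 *: ((f \o shift (x, y)) (h *: (0, 1)) - f (x, y))).
  apply/funext => h; congr (_ *: (f _ - _)).
  by apply/pair_equal_spec; split; rewrite //= scaler0 add0r.
have dfE (y : R) : 'D_1 (fun y : R => f (x, y)) y = 'D_(0, 1) f (x, y).
  by rewrite /derive DE.
under eq_integral do rewrite -dfE.
apply: integral_derive_unit_itv.
- by move=> y; rewrite /derivable DE; exact: df.
- have -> : ('D_1 (fun y : R => f (x, y)) : R -> R) =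
      ('D_(0, 1) f : plane -> R) \o (fun y : R => (x, y)) by exact/funext.
  move=> y; apply: continuous_comp; last exact: cDf.
  by apply: differentiable_continuous; exact: differentiable_pair.
- by have := pf (x, 0) 0 1; rewrite /= add0r addr0.
Qed.

Lemma derive_periodic (v : plane) (f : plane -> R) : periodic f ->
  periodic ('D_v f : plane -> R).
Proof.
move=> pf x m n; rewrite /derive.
set p : plane := (_, _).
have -> : (fun h : R => h^-1 *: ((f \o shift p) (h *: v) - f p)) =
          (fun h : R => h^-1 *: ((f \o shift x) (h *: v) - f x)).
  apply/funext => h; rewrite [f p]pf; congr (_ *: (_ - _)).
  rewrite /= -[in RHS](pf _ m n); congr f.
  by apply/pair_equal_spec; split; rewrite /= addrA.
by [].
Qed.

Lemma smooth_differentiable (f : plane -> R) x : smooth f -> differentiable f x.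
Proof. by move=> sf; exact: sf [::] x. Qed.

Lemma smooth_derivable (f : plane -> R) x v : smooth f -> derivable f x v.
Proof. by move=> sf; exact/diff_derivable/smooth_differentiable. Qed.

Lemma smooth_continuous (f : plane -> R) : smooth f -> continuous f.
Proof. by move=> sf x; exact/differentiable_continuous/smooth_differentiable. Qed.

Lemma smooth_derive (f : plane -> R) v : smooth f -> smooth ('D_v f : plane -> R).
Proof. by move=> sf vs x; have := sf (rcons vs v) x; rewrite foldr_rcons. Qed.

Lemma derive_lin (a : R) (f g : plane -> R) v (x : plane) : differentiable f x ->
  differentiable g x ->
  'D_v (fun x => a * f x + g x) x = a * 'D_v f x + 'D_v g x.
Proof.
move=> df dg.
have d1 : derivable f x v by exact: diff_derivable.
have d2 : derivable g x v by exact: diff_derivable.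
have d3 : derivable (a *: f) x v by exact: derivableZ.
rewrite [LHS](deriveD d3 d2); congr (_ + _); exact: deriveZ.
Qed.

Lemma smooth_lin (a : R) (f g : plane -> R) : smooth f -> smooth g ->
  smooth (fun x => a * f x + g x).
Proof.
move=> sf sg vs.
have -> : foldr (fun v g => 'D_v g) (fun x => a * f x + g x) vs =
  (fun x => a * foldr (fun v g => 'D_v g) f vs x + foldr (fun v g => 'D_v g) g vs x).
  elim: vs => [//|v vs IH] /=; rewrite IH; apply/funext => x.
  exact: derive_lin (sf vs x) (sg vs x).
move=> x; have d1 := sf vs x; have d2 := sg vs x.
have d3 : differentiable (a *: foldr (fun v g => 'D_v g) f vs) x by exact: differentiableZ.
exact: differentiableD d3 d2.
Qed.

Lemma smooth0 : smooth ((fun=> 0) : plane -> R).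
Proof.
move=> vs.
have -> : foldr (fun v g => 'D_v g) (fun=> 0) vs = (fun=> 0) :> (plane -> R).
  elim: vs => [//|v vs /= ->]; apply/funext => x.
  by rewrite derive_cst.
by move=> x; exact: differentiable_cst.
Qed.

Definition torus_direction (v : plane) := v = (1, 0) \/ v = (0, 1).

Lemma integral_derive (f : plane -> R) v : torus_direction v ->
  (forall x, derivable f x v) -> continuous ('D_v f : plane -> R) -> periodic f ->
  \int[mu]_x ('D_v f x) = 0.
Proof.
move=> dv df cDf pf; have pDf := derive_periodic v pf.
case: dv df cDf pDf => -> df cDf pDf; [exact: integral_derive_fst|exact: integral_derive_snd].
Qed.

Lemma torus_smooth_periodic_Re (phi : plane -> C) : torus_smooth phi ->
  periodic (fun x => Re (phi x)).
Proof. by move=> [p _ _] x m n; rewrite p. Qed.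

Lemma torus_smooth_periodic_Im (phi : plane -> C) : torus_smooth phi ->
  periodic (fun x => Im (phi x)).
Proof. by move=> [p _ _] x m n; rewrite p. Qed.

Lemma continuous_mul (f g : plane -> R) : continuous f -> continuous g ->
  continuous (fun x => f x * g x).
Proof. by move=> cf cg x; apply: cvgM; [exact: cf|exact: cg]. Qed.

Lemma continuous_add (f g : plane -> R) : continuous f -> continuous g ->
  continuous (fun x => f x + g x).
Proof. by move=> cf cg x; apply: cvgD; [exact: cf|exact: cg]. Qed.

Lemma continuous_periodic_Lfun2 (f : plane -> R) : continuous f -> periodic f ->
  f \in Lfun mu 2%:E.
Proof.
move=> cf pf; apply/Lfun2P; split; first exact: continuous_measurable_plane.
apply: continuous_torus_integrable; last by move=> x m n; rewrite pf.
by under eq_fun do rewrite expr2; exact: continuous_mul.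
Qed.

Lemma torus_smooth_hmem (phi : plane -> C) : torus_smooth phi -> @hmem R L2 phi.
Proof.
move=> tp; have [_ sr si] := tp; split; apply: continuous_periodic_Lfun2.
- exact: smooth_continuous.
- exact: torus_smooth_periodic_Re.
- exact: smooth_continuous.
- exact: torus_smooth_periodic_Im.
Qed.

Lemma torus_smooth_partial v (phi : plane -> C) : torus_smooth phi ->
  torus_smooth (partial v phi).
Proof.
move=> tp; have [_ sr si] := tp; split.
- move=> x m n; rewrite /partial (derive_periodic v (torus_smooth_periodic_Re tp) x m n).
  by rewrite (derive_periodic v (torus_smooth_periodic_Im tp) x m n).
- exact: (smooth_derive v sr).
- exact: (smooth_derive v si).
Qed.

Lemma torus_smooth_partials i j (phi : plane -> C) : torus_smooth phi ->
  torus_smooth (partials i j phi).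
Proof.
move=> tp; rewrite /partials; elim: i => [|i IH] /=; last exact: torus_smooth_partial.
by elim: j => [|j IH] //=; exact: torus_smooth_partial.
Qed.

Lemma torus_smooth_lin (a : R) (phi psi : hsort (@L2 R)) : torus_smooth phi ->
  torus_smooth psi -> torus_smooth (a%:C *: phi + psi).
Proof.
move=> [p1 r1 i1] [p2 r2 i2]; split.
- by move=> x m n; rewrite !L2E p1 p2.
- rewrite (_ : (fun _ => _) = fun x => a * Re (phi x) + Re (psi x)); first exact: smooth_lin.
  by apply/funext => x; rewrite L2E -Re_scale L2E; case: (_ * _) (psi x) => [? ?] [? ?].
- rewrite (_ : (fun _ => _) = fun x => a * Im (phi x) + Im (psi x)); first exact: smooth_lin.
  by apply/funext => x; rewrite L2E -Im_scale L2E; case: (_ * _) (psi x) => [? ?] [? ?].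
Qed.

Lemma torus_smooth_i (phi : hsort (@L2 R)) : torus_smooth phi ->
  torus_smooth ('i%C *: phi).
Proof.
move=> [p r i]; split.
- by move=> x m n; rewrite !L2E p.
- rewrite (_ : (fun _ => _) = fun x => -1 * Im (phi x) + 0).
    by apply: smooth_lin => //; exact: smooth0.
  by apply/funext => x; rewrite L2E; case: (phi x) => a b /=; ring.
- rewrite (_ : (fun _ => _) = fun x => 1 * Re (phi x) + 0).
    by apply: smooth_lin => //; exact: smooth0.
  by apply/funext => x; rewrite L2E; case: (phi x) => a b /=; ring.
Qed.

Lemma partial_lin v (a : R) (phi psi : hsort (@L2 R)) : torus_smooth phi ->
  torus_smooth psi -> partial v (a%:C *: phi + psi) =
    a%:C *: (partial v phi : hsort (@L2 R)) + partial v psi.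
Proof.
move=> [_ r1 i1] [_ r2 i2].
have dr1 x := smooth_differentiable x r1; have di1 x := smooth_differentiable x i1.
have dr2 x := smooth_differentiable x r2; have di2 x := smooth_differentiable x i2.
apply/funext => x; rewrite !L2E /partial.
have -> : (fun y => Re ((a%:C *: phi + psi) y)) = fun x => a * Re (phi x) + Re (psi x).
  by apply/funext => y; rewrite L2E -Re_scale L2E; case: (_ * _) (psi y) => [? ?] [? ?].
have -> : (fun y => Im ((a%:C *: phi + psi) y)) = fun x => a * Im (phi x) + Im (psi x).
  by apply/funext => y; rewrite L2E -Im_scale L2E; case: (_ * _) (psi y) => [? ?] [? ?].
rewrite (derive_lin a v (dr1 x) (dr2 x)) (derive_lin a v (di1 x) (di2 x)).
by apply/eqP; rewrite eq_complex /= !mul0r subr0 addr0 !eqxx.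
Qed.

Lemma partial_i v (phi : hsort (@L2 R)) : torus_smooth phi ->
  partial v ('i%C *: phi) = 'i%C *: (partial v phi : hsort (@L2 R)).
Proof.
move=> [_ r i].
have dr x := smooth_differentiable x r; have di x := smooth_differentiable x i.
have d0 x := smooth_differentiable x smooth0.
apply/funext => x; rewrite !L2E /partial.
have -> : (fun y => Re (('i%C *: phi) y)) = fun x => -1 * Im (phi x) + 0.
  by apply/funext => y; rewrite L2E; case: (phi y) => a b /=; ring.
have -> : (fun y => Im (('i%C *: phi) y)) = fun x => 1 * Re (phi x) + 0.
  by apply/funext => y; rewrite L2E; case: (phi y) => a b /=; ring.
rewrite (derive_lin (-1) v (di x) (d0 x)) (derive_lin 1 v (dr x) (d0 x)) !derive_cst.
by apply/eqP; rewrite eq_complex /=; apply/andP; split; apply/eqP; ring.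
Qed.

Lemma partials_lin i j (a : R) (phi psi : hsort (@L2 R)) : torus_smooth phi ->
  torus_smooth psi -> partials i j (a%:C *: phi + psi) =
    a%:C *: (partials i j phi : hsort (@L2 R)) + partials i j psi.
Proof.
move=> tp tq; elim: i => [|i IH].
  elim: j => [|j IH] //.
  rewrite [LHS](congr1 (partial (0, 1)) IH) partial_lin//;
  exact: (@torus_smooth_partials 0 j).
rewrite [LHS](congr1 (partial (1, 0)) IH) partial_lin//; exact: torus_smooth_partials.
Qed.

(** The product rule for Re (phi conj psi), a periodic function whose partial derivative integrates
    to zero over the cell. *)
Lemma partial_by_parts v (phi psi : hsort (@L2 R)) : torus_direction v ->
  torus_smooth phi -> torus_smooth psi ->
  rdot (partial v phi : hsort (@L2 R)) psi = - rdot phi (partial v psi).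
Proof.
move=> dv tp tq; have [p1 r1 i1] := tp; have [p2 r2 i2] := tq.
have c1 := smooth_continuous r1; have c2 := smooth_continuous i1.
have c3 := smooth_continuous r2; have c4 := smooth_continuous i2.
have c5 := smooth_continuous (smooth_derive v r1); have c6 := smooth_continuous (smooth_derive v i1).
have c7 := smooth_continuous (smooth_derive v r2); have c8 := smooth_continuous (smooth_derive v i2).
pose F (x : plane) := Re (phi x) * Re (psi x) + Im (phi x) * Im (psi x).
pose G (x : plane) :=
  (Re (partial v phi x) * Re (psi x) + Im (partial v phi x) * Im (psi x)) +
  (Re (phi x) * Re (partial v psi x) + Im (phi x) * Im (partial v psi x)).
have dR (x : plane) : derivable (fun x => Re (phi x) * Re (psi x)) x v.
  by apply: derivableM; exact: smooth_derivable.
have dI (x : plane) : derivable (fun x => Im (phi x) * Im (psi x)) x v.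
  by apply: derivableM; exact: smooth_derivable.
have DF : ('D_v F : plane -> R) = G.
  apply/funext => x.
  rewrite (_ : F = (fun x => Re (phi x) * Re (psi x)) + (fun x => Im (phi x) * Im (psi x)))//.
  rewrite (deriveD (dR x) (dI x)).
  have E1 := deriveM (smooth_derivable r1 (x := x) (v := v)) (smooth_derivable r2 (x := x) (v := v)).
  have E2 := deriveM (smooth_derivable i1 (x := x) (v := v)) (smooth_derivable i2 (x := x) (v := v)).
  rewrite [X in X + _ = _]E1 [X in _ + X = _]E2 /G /partial /=.
  by rewrite /GRing.scale /=; ring.
have : \int[mu]_x ('D_v F x) = 0.
  have h1 x : derivable F x v by exact: derivableD (dR x) (dI x).
  have h2 : continuous ('D_v F : plane -> R).
    rewrite DF; apply: continuous_add; apply: continuous_add.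
    - exact: continuous_mul c5 c3.
    - exact: continuous_mul c6 c4.
    - exact: continuous_mul c1 c7.
    - exact: continuous_mul c2 c8.
  have h3 : periodic F by move=> x m n; rewrite /F p1 p2.
  exact: integral_derive dv h1 h2 h3.
rewrite DF /G RintegralD//.
- by rewrite -!rdot_L2E => /eqP; rewrite addr_eq0 => /eqP.
- exact: integrable_rdot (torus_smooth_hmem (torus_smooth_partial v tp)) (torus_smooth_hmem tq).
- exact: integrable_rdot (torus_smooth_hmem tp) (torus_smooth_hmem (torus_smooth_partial v tq)).
Qed.

End TorusCalculus.

(** * Green's formula for the shifted Laplacian *)

Section Laplacian.
Context {R : realType}.
Local Notation plane := (measurableTypeR R * measurableTypeR R)%type.
Local Notation mu := (@torus_measure R).
Local Notation Re := complex.Re.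
Local Notation Im := complex.Im.
Implicit Types u v w : hsort (@L2 R).

Lemma hmem_i u : hmem u -> @hmem R L2 ('i%C *: u).
Proof. by move=> hu; have := hmem_lin 'i%C hu (hmem0 (@semi_inner_L2 R)); rewrite addr0. Qed.

Lemma rdot_i u v : hmem u -> hmem v -> rdot ('i%C *: u) v = - rdot u ('i%C *: v).
Proof.
move=> hu hv; rewrite -[in RHS](rdotNr (@semi_inner_L2 R) (hmem_i hv) hu) !rdot_L2E.
apply: eq_Rintegral => x _; rewrite !L2E; case: (u x) (v x) => [a b] [c d] /=; ring.
Qed.

Lemma hnorm_i u : hnorm ('i%C *: u) = hnorm u.
Proof.
rewrite /hnorm -/(rdot _ _) -[in RHS]/(rdot _ _) !rdot_L2E; congr Num.sqrt.
apply: eq_Rintegral => x _; rewrite !L2E; case: (u x) => [a b] /=; ring.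
Qed.

Definition strong_limit (f : nat -> hsort (@L2 R)) u :=
  (fun n => hnorm (f n - u)) @ \oo --> (0 : R).

Lemma strong_limit_lin (a : R) (f g : nat -> hsort (@L2 R)) u v :
  (forall n, hmem (f n)) -> (forall n, hmem (g n)) -> hmem u -> hmem v ->
  strong_limit f u -> strong_limit g v ->
  strong_limit (fun n => a%:C *: f n + g n) (a%:C *: u + v).
Proof.
move=> hf hg hu hv fu gv; have HL := (@semi_inner_L2 R).
apply: (squeeze_cvgr (f := fun=> 0)
  (h := fun n => `|a| * hnorm (f n - u) + hnorm (g n - v))).
- apply: nearW => n; rewrite hnorm_ge0/=.
  have hfu := hmemB HL (hf n) hu; have hgv := hmemB HL (hg n) hv.
  rewrite -(hnormZ HL)//.
  have -> : a%:C *: f n + g n - (a%:C *: u + v) = a%:C *: (f n - u) + (g n - v).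
    by rewrite scalerBr opprD addrACA.
  by apply: (hnorm_triangle HL) => //; exact: (hmemZ HL).
- exact: cvg_cst.
- rewrite -[X in _ --> X](addr0 0) -[X in _ --> X + _](mulr0 `|a|).
  by apply: cvgD => //; exact: cvgMr.
Qed.

(** The closure of the classical partial derivative on smooth periodic functions. One sequence
    approximates both [u] and [w], so integration by parts passes to the limit in the inner
    products. *)
Definition weak_partial (e : plane) u w :=
  [/\ hmem u, hmem w & exists phi : nat -> hsort (@L2 R),
    [/\ forall n, torus_smooth (phi n), strong_limit phi u &
        strong_limit (fun n => partial e (phi n)) w]].

Lemma weak_partial_lin e (a : R) u w u' w' : weak_partial e u w ->
  weak_partial e u' w' -> weak_partial e (a%:C *: u + u') (a%:C *: w + w').
Proof.
move=> [hu hw [phi [tphi pu pw]]] [hu' hw' [psi [tpsi pu' pw']]].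
split; [exact: hmem_lin|exact: hmem_lin|].
exists (fun n => a%:C *: phi n + psi n); split.
- by move=> n; exact: torus_smooth_lin.
- by apply: strong_limit_lin => // n; exact: torus_smooth_hmem.
- under eq_fun do rewrite partial_lin//.
  by apply: strong_limit_lin => // n; apply: torus_smooth_hmem;
    exact: torus_smooth_partial.
Qed.

Lemma weak_partial_i e u w : weak_partial e u w ->
  weak_partial e ('i%C *: u) ('i%C *: w).
Proof.
move=> [hu hw [phi [tphi pu pw]]]; split; [exact: hmem_i|exact: hmem_i|].
exists (fun n => 'i%C *: phi n); split.
- by move=> n; exact: torus_smooth_i.
- by rewrite /strong_limit; under eq_fun do rewrite -scalerBr hnorm_i.
- rewrite /strong_limit; under eq_fun do rewrite partial_i// -scalerBr hnorm_i.
  exact: pw.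
Qed.

Lemma weak_partial_by_parts e u w u' w' : torus_direction e -> weak_partial e u w ->
  weak_partial e u' w' -> rdot w u' = - rdot u w'.
Proof.
move=> de [hu hw [phi [tphi pu pw]]] [hu' hw' [psi [tpsi pu' pw']]].
have HL := (@semi_inner_L2 R).
have h1 n : hmem (phi n) by exact: torus_smooth_hmem.
have h2 n : @hmem R L2 (partial e (phi n)).
  by apply: torus_smooth_hmem; exact: torus_smooth_partial.
have h3 n : hmem (psi n) by exact: torus_smooth_hmem.
have h4 n : @hmem R L2 (partial e (psi n)).
  by apply: torus_smooth_hmem; exact: torus_smooth_partial.
have l1 := cvg_rdot HL h2 h3 hw hu' pw pu'.
have l2 := cvg_rdot HL h1 h4 hu hw' pu pw'.
apply: cvg_unique l1 _ => //.
rewrite /= (_ : (fun n => rdot (partial e (phi n) : hsort L2) (psi n)) =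
  (fun n => - rdot (phi n) (partial e (psi n)))); first exact: cvgN.
by apply/funext => n; rewrite partial_by_parts.
Qed.

(** The covariant derivative with real [k] is skew-symmetric: multiplication by i is skew for the
    real inner product, as is the partial derivative. *)
Lemma weak_partial_covariant_by_parts e k u w u' w' : torus_direction e ->
  weak_partial e u w -> weak_partial e u' w' ->
  rdot (k%:C *: ('i%C *: u) + w) u' = - rdot u (k%:C *: ('i%C *: u') + w').
Proof.
move=> de wu wu'; have HL := (@semi_inner_L2 R).
have [hu hw _] := wu; have [hu' hw' _] := wu'.
have h1 := hmem_i hu; have h2 := hmem_i hu'.
have h3 := hmemZ HL k h1; have h4 := hmemZ HL k h2.
rewrite (rdotDl HL)// (rdotDr HL)// (rdotZl HL)// (rdotZr HL)// rdot_i//.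
by rewrite (weak_partial_by_parts de wu wu') opprD mulrN.
Qed.

Lemma H2_derivatives_weak_fst u D i j : H2_derivatives u D -> (i.+1 + j <= 2)%N ->
  weak_partial (1, 0) (D i j) (D i.+1 j).
Proof.
move=> [_ _ [phi [tphi H]]] ij.
have [h1 l1] := H i j (ltnW ij); have [h2 l2] := H i.+1 j ij.
split=> //; exists (fun n => partials i j (phi n)); split=> // n.
exact: torus_smooth_partials.
Qed.

(** [partials i j] takes the derivatives in the second variable innermost, so raising [j] is a final
    differentiation only for [i = 0]. The Laplacian has no mixed derivatives, and this case
    suffices. *)
Lemma H2_derivatives_weak_snd u D j : H2_derivatives u D -> (j.+1 <= 2)%N ->
  weak_partial (0, 1) (D 0%N j) (D 0%N j.+1).
Proof.
move=> [_ _ [phi [tphi H]]] ij.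
have [h1 l1] := H 0%N j (ltnW ij); have [h2 l2] := H 0%N j.+1 ij.
split=> //; exists (fun n => partials 0 j (phi n)); split=> // n.
exact: torus_smooth_partials.
Qed.

Lemma H2_derivatives_lin (a : R) u D v E : H2_derivatives u D -> H2_derivatives v E ->
  H2_derivatives (a%:C *: u + v) (fun i j => a%:C *: D i j + E i j).
Proof.
move=> [hu uD [phi [tphi H]]] [hv vE [psi [tpsi K]]]; split.
- exact: hmem_lin.
- by apply: filterS2 uD vE => x /= e1 e2 _; rewrite !L2E e1// e2.
exists (fun n => (a%:C *: (phi n : hsort (@L2 R)) + (psi n : hsort (@L2 R)) : hsort (@L2 R))); split.
  by move=> n; exact: torus_smooth_lin.
move=> i j ij; have [h1 l1] := H i j ij; have [h2 l2] := K i j ij.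
split; first exact: hmem_lin.
under eq_fun do rewrite partials_lin//.
by apply: strong_limit_lin => // n; apply: torus_smooth_hmem; exact: torus_smooth_partials.
Qed.

Lemma shifted_laplacian_lin k (a : R) u v u' v' : shifted_laplacian k u v ->
  shifted_laplacian k u' v' -> shifted_laplacian k (a%:C *: u + u') (a%:C *: v + v').
Proof.
move=> [D [HD hv E]] [D' [HD' hv' E']].
exists (fun i j => a%:C *: D i j + D' i j); split.
- exact: H2_derivatives_lin.
- exact: hmem_lin.
- by apply: filterS2 E E' => x /= e1 e2 _; rewrite !L2E e1// e2//; ring.
Qed.

(** The shifted Laplacian is the sum of the squares of the two covariant derivatives, each of which
    is moved once to the other argument. The terms [e1] and [e2] in the proof are the weak
    derivatives of the first-order covariant ones. *)
Lemma shifted_laplacian_green k u v u' (D D' : nat -> nat -> hsort (@L2 R)) :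
  H2_derivatives u D -> H2_derivatives u' D' -> hmem v ->
  v = (fun x => D 2%N 0%N x + D 0%N 2%N x
        + 2 * 'i%C * (k.1%:C * D 1%N 0%N x + k.2%:C * D 0%N 1%N x)
        - (k.1 ^+ 2 + k.2 ^+ 2)%:C * u x) %[ae mu] ->
  rdot v u' =
    - rdot (k.1%:C *: ('i%C *: D 0%N 0%N) + D 1%N 0%N)
           (k.1%:C *: ('i%C *: D' 0%N 0%N) + D' 1%N 0%N)
    - rdot (k.2%:C *: ('i%C *: D 0%N 0%N) + D 0%N 1%N)
           (k.2%:C *: ('i%C *: D' 0%N 0%N) + D' 0%N 1%N).
Proof.
move=> HD HD' hv vE; have HL := (@semi_inner_L2 R).
have w1 := H2_derivatives_weak_fst HD (isT : (1 + 0 <= 2)%N).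
have w2 := H2_derivatives_weak_fst HD (isT : (2 + 0 <= 2)%N).
have w3 := H2_derivatives_weak_snd HD (isT : (1 <= 2)%N).
have w4 := H2_derivatives_weak_snd HD (isT : (2 <= 2)%N).
have w1' := H2_derivatives_weak_fst HD' (isT : (1 + 0 <= 2)%N).
have w3' := H2_derivatives_weak_snd HD' (isT : (1 <= 2)%N).
have e1 := weak_partial_lin k.1 (weak_partial_i w1) w2.
have e2 := weak_partial_lin k.2 (weak_partial_i w3) w4.
have d1 : torus_direction ((1, 0) : plane) by left.
have d2 : torus_direction ((0, 1) : plane) by right.
rewrite -(weak_partial_covariant_by_parts k.1 d1 e1 w1').
rewrite -(weak_partial_covariant_by_parts k.2 d2 e2 w3').
have [hE1 hF1 _] := e1; have [hE2 hF2 _] := e2.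
have [hD0 _ _] := w1'; have [hD00 _ _] := w1.
have hG1 := hmem_lin k.1%:C (hmem_i hE1) hF1.
have hG2 := hmem_lin k.2%:C (hmem_i hE2) hF2.
rewrite -(rdotDl HL)//.
have [hu uD _] := HD; have [hu' uD' _] := HD'.
congr complex.Re; apply: hdot_aeE => //; first exact: (hmemD HL).
apply: filterS3 vE uD uD' => x /= -> // uDx -> // _; congr (_ * _).
rewrite uDx// !L2E; move: (D 2%N 0%N x) (D 0%N 2%N x) (D 1%N 0%N x) (D 0%N 1%N x) (D 0%N 0%N x).
move: k.1 k.2 => k1 k2 p q r s t.
have ii : 'i%C * 'i%C = -1 :> R[i] by rewrite -expr2 sqr_i.
rewrite rmorphD !rmorphXn /=.
by ring: ii.
Qed.

End Laplacian.

(** * The operator A_k *)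

Section Lorentz.
Context {R : realType}.
Local Notation plane := (measurableTypeR R * measurableTypeR R)%type.
Local Notation mu := (@torus_measure R).
Local Notation Re := complex.Re.
Local Notation Im := complex.Im.
Implicit Types u v w : hsort (@L2 R).

Lemma negligible_torus (N : set plane) : (@lebesgue2 R).-negligible N -> mu.-negligible N.
Proof.
move=> [B [mB B0 NB]]; exists B; split=> //.
apply/eqP; rewrite eq_le measure_ge0 andbT -B0 /= /mrestr.
apply: le_measure; rewrite ?inE//.
by apply: measurableI => //; exact: measurable_cell.
Qed.

Lemma ae_cell : {ae mu, forall x, @cell R x}.
Proof.
exists (~` @cell R); split=> //; first by apply: measurableC; exact: measurable_cell.
by rewrite /= /mrestr setICl measure0.
Qed.

(** A set of the completed sigma-algebra is a Borel set united with a negligible one; the Borel part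
    serves as replacement. *)
Lemma lebesgue_measurable2_borel (A : set plane) : lebesgue_measurable2 A ->
  exists2 B : set plane, measurable B & {ae mu, forall x, \1_A x = \1_B x :> R}.
Proof.
move=> [B mB [N nN <-]]; exists B => //.
apply: (negligibleS _ (negligible_torus nN)) => x /= H.
apply: contrapT => Nx; apply: H; rewrite !indicE; congr (_%:R).
congr nat_of_bool; apply/idP/idP; rewrite !inE; last by left.
by case.
Qed.

(** For a Borel version [O] of [Omega1] this represents [P1] followed by the inclusion of its range
    in [L2]. *)
Definition restriction (O : set plane) u : hsort (@L2 R) := fun x => (\1_O x)%:C * u x.

Section Restriction.
Variable O : set plane.
Hypothesis mO : measurable O.

Lemma restriction_conj u x :
  (restriction O u x)^*%C = (\1_O x)%:C * (u x)^*%C.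
Proof.
rewrite /restriction; case: (u x) => a b; apply/eqP; rewrite eq_complex /=.
by apply/andP; split; apply/eqP; ring.
Qed.

Lemma indicC_idem x : (\1_O x)%:C * (\1_O x)%:C = (\1_O x)%:C :> R[i].
Proof. by rewrite indicE; case: (_ \in _); rewrite ?mul1r ?mul0r. Qed.

Lemma hmem_restriction u : hmem u -> hmem (restriction O u).
Proof.
move=> hu; have [h1 h2] := hu; split.
  apply: Lfun2_dominated h1.
    under eq_fun do rewrite Re_scale.
    by apply: measurable_funM; [exact: measurable_indic|exact: hmem_measurable_Re].
  move=> x; rewrite Re_scale normrM ler_piMl//.
  by rewrite indicE; case: (_ \in _); rewrite ?normr1 ?normr0.
apply: Lfun2_dominated h2.
  under eq_fun do rewrite Im_scale.
  by apply: measurable_funM; [exact: measurable_indic|exact: hmem_measurable_Im].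
move=> x; rewrite Im_scale normrM ler_piMl//.
by rewrite indicE; case: (_ \in _); rewrite ?normr1 ?normr0.
Qed.

Lemma restriction_lin (a : R) u v :
  restriction O (a%:C *: u + v) = a%:C *: restriction O u + restriction O v.
Proof. by apply/funext => x; rewrite /restriction !L2E; ring. Qed.

Lemma rdot_restriction u : hmem u ->
  rdot (restriction O u) (restriction O u) = rdot (restriction O u) u.
Proof.
move=> hu; have hP := hmem_restriction hu; congr complex.Re; apply: hdot_aeE => //.
apply: aeW => x _; rewrite restriction_conj /restriction mulrACA indicC_idem.
by rewrite mulrA.
Qed.

Lemma rdot_restriction_sym u v : hmem u -> hmem v ->
  rdot (restriction O u) v = rdot u (restriction O v).
Proof.
move=> hu hv; have hP := hmem_restriction hu; have hQ := hmem_restriction hv.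
congr complex.Re; apply: hdot_aeE => //.
by apply: aeW => x _; rewrite restriction_conj /restriction; ring.
Qed.

Lemma hnorm_restriction u : hmem u -> hnorm (restriction O u) <= hnorm u.
Proof.
move=> hu; have HL := @semi_inner_L2 R; have hP := hmem_restriction hu.
have [->|P0] := eqVneq (hnorm (restriction O u)) 0; first exact: hnorm_ge0.
have Pp : 0 < hnorm (restriction O u) by rewrite lt_neqAle eq_sym P0 hnorm_ge0.
rewrite -(ler_pM2l Pp) -expr2 (sqr_hnorm HL)// rdot_restriction//.
by apply: le_trans (cauchy_schwarz HL hP hu); exact: ler_norm.
Qed.

End Restriction.

Section Operator.
Variables (Omega1 Omega2 O1 : set plane) (a1 a2 b11 b12 : R) (k : plane).
Hypotheses (mO1 : measurable O1)
  (aeO1 : {ae mu, forall x, \1_Omega1 x = \1_O1 x :> R})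
  (partU : @cell R = Omega1 `|` Omega2) (partI : Omega1 `&` Omega2 = set0)
  (a1_gt0 : 0 < a1) (a2_gt0 : 0 < a2) (b11_gt0 : 0 < b11) (b12_gt0 : 0 < b12).

Local Notation A := (opA Omega1 Omega2 a1 a2 b11 b12 k).
Local Notation W := (W Omega1 Omega2 a1 a2).
Let beta := (b11 + b12) / a1.

Let beta_ge0 : 0 <= beta.
Proof. by rewrite divr_ge0 ?ltW// addr_gt0. Qed.

Lemma W_gt0 x : @cell R x -> 0 < W x.
Proof.
rewrite partU /Defs.W !indicE => -[] Ox.
  have nO2 : x \in Omega2 = false.
    by apply/negP; rewrite inE => O2x; have : set0 x by rewrite -partI.
  by rewrite (mem_set Ox) nO2 mulr1 mulr0 addr0.
have nO1 : x \in Omega1 = false.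
  by apply/negP; rewrite inE => O1x; have : set0 x by rewrite -partI.
by rewrite (mem_set Ox) nO1 mulr1 mulr0 add0r.
Qed.

Lemma opA_mem u v : A u v -> hmem u /\ hmem v. Proof. by case. Qed.

Lemma opA_lin (a : R) u v u' v' : A u v -> A u' v' ->
  A (a%:C *: u + u') (a%:C *: v + v').
Proof.
move=> [hu hv [h [g [L E F]]]] [hu' hv' [h' [g' [L' E' F']]]].
split; [exact: hmem_lin|exact: hmem_lin|].
exists (a%:C *: h + h'), (a%:C *: g + g'); split.
- exact: shifted_laplacian_lin.
- by apply: filterS2 E E' => x /= e e' _; rewrite !L2E e// e'//; ring.
- by apply: filterS2 F F' => x /= e e' _; rewrite !L2E e// e'//; ring.
Qed.

(* The weight [W^(-1/2)] in [A u] cancels the weight [W^(1/2)] in [u']. *)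
Lemma opA_form u v u' h g h' g' : hmem u -> hmem v -> hmem u' ->
  shifted_laplacian k h g -> shifted_laplacian k h' g' ->
  u = (fun x => (Num.sqrt (W x))%:C * h x) %[ae mu] ->
  v = (fun x => - ((Num.sqrt (W x))^-1)%:C * g x
                + (beta * \1_Omega1 x)%:C * u x) %[ae mu] ->
  u' = (fun x => (Num.sqrt (W x))%:C * h' x) %[ae mu] ->
  rdot v u' = - rdot g h' + beta * rdot (restriction O1 u) u'.
Proof.
move=> hu hv hu' [D [HD hg gE]] [D' [[hh' _ _] _ _]] uE vE uE'.
have hP := hmem_restriction mO1 hu.
have HL := @semi_inner_L2 R.
have hng := hmemN HL hg; have hbP := hmemZ HL beta hP.
rewrite -(rdotNl HL)// -(rdotZl HL)// !rdot_L2E -RintegralD//; last 2 first.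
- exact: integrable_rdot.
- exact: integrable_rdot.
apply: Rintegral_ae_eq.
- exact: measurable_rdot.
- apply: measurable_funD.
  + exact: measurable_rdot.
  + exact: measurable_rdot.
(* [W] is positive only on the cell, whose complement is null for [torus_measure]; on the cell the
   square root cancels against its inverse. *)
apply: filterS2 vE (filterI uE' (filterI aeO1 ae_cell)) => x /= e [e' [eO xc]] _.
rewrite (e I) (e' I) !L2E /restriction eO.
have s0 : Num.sqrt (W x) != 0 by rewrite gt_eqF// sqrtr_gt0; exact: W_gt0.
move: (\1_O1 x) (Num.sqrt (W x)) s0 (u x) (g x) (h' x) => i s s0 [p q] [p' q'] [r t] /=.
by field.
Qed.

Lemma opA_symmetric : symmetric_operator A.
Proof.
split; [exact: opA_mem|exact: opA_lin|].
move=> u v u' v' [hu hv [h [g [L E F]]]] [hu' hv' [h' [g' [L' E' F']]]].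
have HL := @semi_inner_L2 R.
rewrite (opA_form hu hv hu' L L' E F E') (rdotC HL hu hv').
rewrite (opA_form hu' hv' hu L' L E' F' E).
rewrite rdot_restriction_sym// (rdotC HL hu (hmem_restriction mO1 hu')).
congr (- _ + _).
have [D [HD hg gE]] := L; have [D' [HD' hg' gE']] := L'.
rewrite (shifted_laplacian_green HD HD' hg gE) (shifted_laplacian_green HD' HD hg' gE').
have w1 := H2_derivatives_weak_fst HD (isT : (1 + 0 <= 2)%N).
have w3 := H2_derivatives_weak_snd HD (isT : (1 <= 2)%N).
have w1' := H2_derivatives_weak_fst HD' (isT : (1 + 0 <= 2)%N).
have w3' := H2_derivatives_weak_snd HD' (isT : (1 <= 2)%N).
have [h1 h2 _] := w1; have [_ h3 _] := w3; have [h1' h2' _] := w1'; have [_ h3' _] := w3'.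
have m1 := hmem_lin k.1%:C (hmem_i h1) h2; have m2 := hmem_lin k.2%:C (hmem_i h1) h3.
have m1' := hmem_lin k.1%:C (hmem_i h1') h2'; have m2' := hmem_lin k.2%:C (hmem_i h1') h3'.
by congr (- _ - _); exact: (rdotC HL).
Qed.

(** By Green's formula the form of [A] at [u] is the sum of the squared norms of the covariant
    derivatives of [h] and of [beta] times the squared norm of the restriction of [u]. *)
Lemma opA_ge0 : lower_bounded A 0.
Proof.
move=> u v [hu hv [h [g [L E F]]]].
have HL := @semi_inner_L2 R.
rewrite mul0r (opA_form hu hv hu L L E F E) -rdot_restriction//.
have [D [HD hg gE]] := L.
rewrite (shifted_laplacian_green HD HD hg gE) opprD !opprK.
have w1 := H2_derivatives_weak_fst HD (isT : (1 + 0 <= 2)%N).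
have w3 := H2_derivatives_weak_snd HD (isT : (1 <= 2)%N).
have [h1 h2 _] := w1; have [_ h3 _] := w3.
have m1 := hmem_lin k.1%:C (hmem_i h1) h2; have m2 := hmem_lin k.2%:C (hmem_i h1) h3.
apply: addr_ge0; first by apply: addr_ge0; exact: (rdot_ge0 HL).
apply: mulr_ge0; first exact: beta_ge0.
by apply: (rdot_ge0 HL); exact: hmem_restriction.
Qed.

Lemma opA_resolvent_set c : min_spectrum_gt A c -> exists2 m : R, c < m &
  lower_bounded A m /\ forall x : R, x < m -> resolvent_set A x%:C.
Proof.
move=> [m [_ lbm cm]]; exists m => //.
have res x : x < m -> resolvent_set A x%:C.
  move=> xm; apply: contrapT => nx.
  have := lbm _ nx; rewrite lecR => mx.
  by move: xm; rewrite ltNge mx.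
split=> //; apply: lower_bounded_spectrum res => //.
- exact: semi_inner_L2.
- exact: opA_symmetric.
- exact: opA_ge0.
Qed.

End Operator.
End Lorentz.

(** * The coupling operators and the Schur complement *)

Section Coupling.
Context {R : realType}.
Local Notation plane := (measurableTypeR R * measurableTypeR R)%type.
Local Notation mu := (@torus_measure R).
Implicit Types u v w : hsort (@L2 R).

Variables (Omega1 O1 : set plane) (a1 : R).
Hypotheses (mO1 : measurable O1)
  (aeO1 : {ae mu, forall x, \1_Omega1 x = \1_O1 x :> R}).

Lemma ranP1_mem y : @hmem R (ranP1 Omega1) y -> @hmem R L2 y. Proof. by case. Qed.

Lemma ranP1_restriction u : hmem u -> @hmem R (ranP1 Omega1) (restriction O1 u).
Proof.
move=> hu; split; first exact: hmem_restriction.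
apply: filterS aeO1 => x /= e [_ nx]; rewrite /restriction -e indicE.
by rewrite memNset// mul0r.
Qed.

Lemma ranP1_restrictionE y : @hmem R (ranP1 Omega1) y ->
  restriction O1 y = y %[ae mu].
Proof.
move=> [hy y0]; apply: filterS2 y0 (filterI aeO1 (@ae_cell R)) => x /= H [e xc] _.
rewrite /restriction -e indicE; have [xO|xO] := pselect (Omega1 x).
  by rewrite mem_set// mul1r.
by rewrite memNset// mul0r H.
Qed.

Lemma ranP1_lin (a : R) y y' : @hmem R (ranP1 Omega1) y -> @hmem R (ranP1 Omega1) y' ->
  @hmem R (ranP1 Omega1) (a%:C *: y + y').
Proof.
move=> [hy y0] [hy' y0']; split; first exact: hmem_lin.
by apply: filterS2 y0 y0' => x /= e e' xO; rewrite !L2E (e xO) (e' xO) mulr0 addr0.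
Qed.

Lemma ranP1Z (a : R) (y : hsort (@L2 R)) : @hmem R (ranP1 Omega1) y ->
  @hmem R (ranP1 Omega1) (a%:C *: y).
Proof.
have r0 : @hmem R (ranP1 Omega1) (0 : hsort (@L2 R)).
  by split; [exact: hmem0 (@semi_inner_L2 R)|exact: aeW].
by move=> hy; have := ranP1_lin a hy r0; rewrite addr0.
Qed.

Variables c b : R.
Let s := Num.sqrt (c * b / a1).

Lemma opBstar_mem u p : opBstar Omega1 a1 c b u p ->
  [/\ hmem u, @hmem R L2 p & p = s%:C *: restriction O1 u %[ae mu]].
Proof.
move=> [q [[hu hq qE] ->]]; split=> //.
  by rewrite -[X in hmem X]addr0; apply: hmem_lin; [exact: ranP1_mem|exact: hmem0 (@semi_inner_L2 R)].
by apply: filterS2 qE aeO1 => x /= e e1 _; rewrite !L2E e// /restriction e1.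
Qed.

Lemma opBstar_restriction u : hmem u ->
  opBstar Omega1 a1 c b u (s%:C *: restriction O1 u).
Proof.
move=> hu; exists (restriction O1 u); split=> //; split=> //.
  exact: ranP1_restriction.
by apply: filterS aeO1 => x /= e _; rewrite /restriction e.
Qed.

(** [y] agrees almost everywhere with its own restriction, so the indicator can be moved across the
    product and absorbed. *)
Lemma restriction_hdotE u (y : hsort (@L2 R)) : hmem u -> @hmem R (ranP1 Omega1) y ->
  hdot (s%:C *: restriction O1 u) y = hdot u (s%:C *: y).
Proof.
move=> hu hy; have h0 := hmem0 (@semi_inner_L2 R).
have hy2 := ranP1_mem hy.
have hP := hmem_restriction mO1 hu.
have hsP := hmemZ (@semi_inner_L2 R) s hP.
have hsy := hmemZ (@semi_inner_L2 R) s hy2.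
apply: hdot_aeE => //.
apply: filterS (ranP1_restrictionE hy) => x /= e _.
rewrite !L2E -(e I) restriction_conj.
have -> : (s%:C * restriction O1 y x)^*%C = s%:C * ((\1_O1 x)%:C * (y x)^*%C).
  rewrite -restriction_conj; case: (restriction O1 y x) => p q.
  by apply/eqP; rewrite eq_complex /=; apply/andP; split; apply/eqP; ring.
by rewrite /restriction -[in RHS]indicC_idem; ring.
Qed.

(** Testing the adjoint identity with [d = f - s y] gives (d, f) = (d, s y), so [d] has norm
    zero. *)
Lemma opB_mem y f : opB Omega1 a1 c b y f ->
  [/\ @hmem R (ranP1 Omega1) y, hmem f & f = s%:C *: y %[ae mu]].
Proof.
move=> [hy hf H]; split=> //; have HL := @semi_inner_L2 R.
have hsy := hmemZ HL s (ranP1_mem hy).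
apply: hnormB_eq0_ae => //.
have hd := hmemB HL hf hsy.
have E := H _ _ (opBstar_restriction hd).
have E' : hdot (s%:C *: restriction O1 (f - s%:C *: y)) y = hdot (f - s%:C *: y) (s%:C *: y).
  exact: restriction_hdotE.
have : rdot (f - s%:C *: y) (f - s%:C *: y) = 0.
  rewrite (rdotBr HL)// /rdot -E'.
  by rewrite [hdot _ y]E subrr.
by rewrite -(sqr_hnorm HL)// => /eqP; rewrite sqrf_eq0 => /eqP.
Qed.

Lemma opB_scale y : @hmem R (ranP1 Omega1) y -> opB Omega1 a1 c b y (s%:C *: y).
Proof.
move=> hy; have HL := @semi_inner_L2 R; have hy2 := ranP1_mem hy.
have hsy := hmemZ HL s hy2.
split=> // u p Bup; have [hu hp pE] := opBstar_mem Bup.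
rewrite -(restriction_hdotE hu hy); apply: hdot_aeE => //.
  by apply: (hmemZ HL); exact: hmem_restriction.
by apply: filterS pE => x /= e _; rewrite e.
Qed.

End Coupling.

(** * A priori bound and solvability for the Schur complement *)

Section Schur.
Context {R : realType}.
Local Notation plane := (measurableTypeR R * measurableTypeR R)%type.
Local Notation mu := (@torus_measure R).
Implicit Types u v w : hsort (@L2 R).

Variables (O1 : set plane) (A : operator (@L2 R) L2) (m l psi s1 s2 k1 k2 : R).
Hypotheses (mO1 : measurable O1) (sA : symmetric_operator A) (Am : lower_bounded A m)
  (l0 : 0 <= l) (lm : l < m) (psi0 : 0 <= psi) (k10 : k1 != 0) (k20 : k2 != 0)
  (psiE : psi = - (s1 ^+ 2 / k1 + s2 ^+ 2 / k2)).

Let HL := @semi_inner_L2 R.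

(** Subtracting [s1 / k1] and [s2 / k2] times the lower rows from the first one eliminates [y1] and
    [y2] and, by [psiE], leaves the Schur complement acting on [u]. In the application [k1], [k2]
    are [c11 - l], [c12 - l]. The bound serves both injectivity, through differences, and
    boundedness of the inverse. *)
Lemma schur_bound : exists2 M : R, 0 <= M & forall (u w y1 y2 g1 g2 g3 : hsort (@L2 R)),
  A u w -> hmem y1 -> hmem y2 -> hmem g1 -> hmem g2 -> hmem g3 ->
  g1 = w - l%:C *: u + s1%:C *: y1 + s2%:C *: y2 %[ae mu] ->
  g2 = s1%:C *: restriction O1 u + k1%:C *: y1 %[ae mu] ->
  g3 = s2%:C *: restriction O1 u + k2%:C *: y2 %[ae mu] ->
  hnorm u + hnorm y1 + hnorm y2 <= M * (hnorm g1 + hnorm g2 + hnorm g3).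
Proof.
(* The first factor comes from [perturbation_bound]; the second dominates the coefficients 1, s1 /
   k1 and s2 / k2 of [g1], [g2] and [g3] after elimination. *)
pose M1 := (m - l)^-1 * (1 + `|s1 / k1| + `|s2 / k2|).
have ml0 : 0 < m - l by rewrite subr_gt0.
have M10 : 0 <= M1.
  by rewrite mulr_ge0 ?invr_ge0 ?(ltW ml0)// !addr_ge0.
have step (s k : R) (u y g : hsort (@L2 R)) : k != 0 -> hmem u -> hmem y -> hmem g ->
    g = s%:C *: restriction O1 u + k%:C *: y %[ae mu] ->
    hnorm y <= `|k^-1| * hnorm g + `|s / k| * hnorm u.
  move=> k0 hu hy hg gE.
  have hP := hmem_restriction mO1 hu.
  have h1 := hmemZ HL (k^-1) hg; have h2 := hmemZ HL (- (s / k)) hP.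
  have -> : hnorm y = hnorm (k^-1%:C *: g + (- (s / k))%:C *: restriction O1 u).
    apply: (hnorm_eq0_congr HL) => //; first exact: (hmemD HL).
    apply: hnormB_aeE => //; first exact: (hmemD HL).
    apply: filterS gE => x /= e _; rewrite !L2E e// !L2E.
    rewrite rmorphN rmorphM /=.
    have kk : k%:C * (k^-1)%:C = 1 :> R[i] by rewrite -rmorphM mulfV.
    by ring: kk.
  apply: le_trans (hnorm_triangle HL h1 h2) _; rewrite !(hnormZ HL)// normrN.
  by rewrite lerD2l ler_wpM2l//; exact: hnorm_restriction.
pose N := 1 + M1 + (`|k1^-1| + `|s1 / k1| * M1) + (`|k2^-1| + `|s2 / k2| * M1).
have N0 : 0 <= N.
  by do ?[exact: normr_ge0 | exact: ler01 | exact: M10 | apply: addr_ge0 | apply: mulr_ge0].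
exists N => // u w y1 y2 g1 g2 g3 Auw hy1 hy2 hg1 hg2 hg3 e1 e2 e3.
have [hu hw] := symop_mem sA Auw.
have hP := hmem_restriction mO1 hu.
pose S := w - l%:C *: u + psi%:C *: restriction O1 u.
have hS : hmem S.
  by apply: (hmemD HL); [apply: (hmemB HL) => //|]; exact: (hmemZ HL).
pose G := hnorm g1 + hnorm g2 + hnorm g3.
have G0 : 0 <= G by rewrite !addr_ge0 ?hnorm_ge0.
have hm2 := hmemZ HL (- (s1 / k1)) hg2; have hm3 := hmemZ HL (- (s2 / k2)) hg3.
have SE : hnorm S = hnorm (g1 + (- (s1 / k1))%:C *: g2 + (- (s2 / k2))%:C *: g3).
  have hr : hmem (g1 + (- (s1 / k1))%:C *: g2 + (- (s2 / k2))%:C *: g3).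
    by apply: (hmemD HL) => //; exact: (hmemD HL).
  apply: (hnorm_eq0_congr HL) => //; apply: hnormB_aeE => //.
  apply: filterS2 e1 (filterI e2 e3) => x /= E1 [E2 E3] _.
  rewrite /S !L2E E1// E2// E3// !L2E psiE.
  rewrite !(rmorphN, rmorphD, rmorphM, rmorphXn) /=.
  have kk1 : k1%:C * (k1^-1)%:C = 1 :> R[i] by rewrite -rmorphM mulfV.
  have kk2 : k2%:C * (k2^-1)%:C = 1 :> R[i] by rewrite -rmorphM mulfV.
  by ring: kk1 kk2.
have uG : hnorm u <= M1 * G.
  rewrite -mulrA mulrC -ler_pdivrMr ?invr_gt0// invrK mulrC.
  have := perturbation_bound HL sA l (fun u => hmem_restriction mO1 (u := u))
    (rdot_restriction mO1) Am psi0 Auw.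
  move=> /le_trans; apply; rewrite -/S SE.
  apply: le_trans (hnorm_triangle HL (hmemD HL hg1 hm2) hm3) _.
  apply: le_trans (lerD (hnorm_triangle HL hg1 hm2) (lexx _)) _.
  rewrite !(hnormZ HL)// !normrN.
  have g1G : hnorm g1 <= G by rewrite /G -addrA lerDl addr_ge0 ?hnorm_ge0.
  have g2G : hnorm g2 <= G by rewrite /G addrAC lerDr addr_ge0 ?hnorm_ge0.
  have g3G : hnorm g3 <= G by rewrite /G lerDr addr_ge0 ?hnorm_ge0.
  rewrite !mulrDl mul1r; apply: lerD; first apply: lerD => //.
    by rewrite ler_wpM2l.
  by rewrite ler_wpM2l.
have g2G : hnorm g2 <= G by rewrite /G addrAC lerDr addr_ge0 ?hnorm_ge0.
have g3G : hnorm g3 <= G by rewrite /G lerDr addr_ge0 ?hnorm_ge0.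
have -> : N * G = G + M1 * G + (`|k1^-1| * G + `|s1 / k1| * (M1 * G))
    + (`|k2^-1| * G + `|s2 / k2| * (M1 * G)).
  by rewrite /N; move: (M1) => X; ring.
apply: lerD; first apply: lerD.
- by apply: le_trans uG _; rewrite lerDr.
- apply: le_trans (step s1 k1 u y1 g2 k10 hu hy1 hg2 e2) _.
  by apply: lerD; rewrite ler_wpM2l.
- apply: le_trans (step s2 k2 u y2 g3 k20 hu hy2 hg3 e3) _.
  by apply: lerD; rewrite ler_wpM2l.
Qed.

(** The two parenthesised expressions are [y1] and [y2] as given by the lower rows. Collecting the
    multiples of the restriction of [u] turns the first row into the Schur equation with data f1 -
    (s1 / k1) f2 - (s2 / k2) f3. *)
Lemma schur_solve (f1 f2 f3 : hsort (@L2 R)) : (forall x : R, x < m -> resolvent_set A x%:C) ->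
  hmem f1 -> hmem f2 -> hmem f3 -> exists u w, [/\ A u w,
    hnorm (w - l%:C *: u
      + s1%:C *: (k1^-1%:C *: f2 - (s1 / k1)%:C *: restriction O1 u)
      + s2%:C *: (k2^-1%:C *: f3 - (s2 / k2)%:C *: restriction O1 u) - f1) = 0 &
    hmem u].
Proof.
move=> res hf1 hf2 hf3.
have hm2 := hmemZ HL (- (s1 / k1)) hf2; have hm3 := hmemZ HL (- (s2 / k2)) hf3.
have hr : hmem (f1 + (- (s1 / k1))%:C *: f2 + (- (s2 / k2))%:C *: f3).
  by apply: (hmemD HL) => //; exact: (hmemD HL).
have [u [w [Auw E]]] := perturbation_surjective HL sA
  (fun u => hmem_restriction mO1 (u := u)) (restriction_lin O1)
  (rdot_restriction mO1) Am l0 lm psi0 (@geometric_complete_L2 R) res hr.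
exists u, w; have [hu hw] := symop_mem sA Auw; split=> //.
rewrite -[RHS]E; congr (hnorm _); apply/funext => x.
rewrite !L2E psiE !(rmorphN, rmorphD, rmorphM, rmorphXn, fmorphV) /=.
by ring.
Qed.

End Schur.

(** * Components and norms in the direct sum *)

Section DirectSum.
Context {R : realType}.
Variables H K : hilbert R.
Implicit Types p q : hsort (hsum H K).

Lemma hsum_fstB p q : (p - q).1 = p.1 - q.1 :> hsort H. Proof. by []. Qed.
Lemma hsum_sndB p q : (p - q).2 = p.2 - q.2 :> hsort K. Proof. by []. Qed.
Lemma hsum_fstZ z p : (z *: p).1 = z *: p.1 :> hsort H. Proof. by []. Qed.
Lemma hsum_sndZ z p : (z *: p).2 = z *: p.2 :> hsort K. Proof. by []. Qed.
Definition hsumE := (hsum_fstB, hsum_sndB, hsum_fstZ, hsum_sndZ).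

End DirectSum.

Section ThreeSum.
Context {R : realType}.
Variable Omega1 : set (measurableTypeR R * measurableTypeR R).
Let K := hsum (@L2 R) (hsum (ranP1 Omega1) (ranP1 Omega1)).

Lemma hnorm_sum3E (u : hsort K) : @hmem R L2 u.1 -> @hmem R L2 u.2.1 ->
  @hmem R L2 u.2.2 ->
  hnorm u = Num.sqrt (@hnorm R L2 u.1 ^+ 2 + @hnorm R L2 u.2.1 ^+ 2 + @hnorm R L2 u.2.2 ^+ 2).
Proof.
move=> h1 h2 h3; have HL := @semi_inner_L2 R.
rewrite !(sqr_hnorm HL)// /hnorm /rdot /=; congr Num.sqrt.
by case: (l2dot u.1 u.1) (l2dot u.2.1 u.2.1) (l2dot u.2.2 u.2.2) =>
  [? ?] [? ?] [? ?] /=; rewrite addrA.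
Qed.

Lemma hnorm_sum3_le (u : hsort K) : @hmem R L2 u.1 -> @hmem R L2 u.2.1 ->
  @hmem R L2 u.2.2 ->
  hnorm u <= @hnorm R L2 u.1 + @hnorm R L2 u.2.1 + @hnorm R L2 u.2.2.
Proof.
move=> h1 h2 h3; rewrite hnorm_sum3E//.
have := @hnorm_ge0 R L2 u.1; have := @hnorm_ge0 R L2 u.2.1; have := @hnorm_ge0 R L2 u.2.2.
move: (hnorm _) (hnorm _) (hnorm _) => a b c a0 b0 c0.
have s0 : 0 <= a + b + c by rewrite !addr_ge0.
rewrite -[leRHS]ger0_norm// -sqrtr_sqr ler_wsqrtr//.
by have := mulr_ge0 a0 b0; have := mulr_ge0 a0 c0; have := mulr_ge0 b0 c0; lra.
Qed.

Lemma le_hnorm_sum3 (u : hsort K) : @hmem R L2 u.1 -> @hmem R L2 u.2.1 ->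
  @hmem R L2 u.2.2 ->
  @hnorm R L2 u.1 + @hnorm R L2 u.2.1 + @hnorm R L2 u.2.2 <= 3 * hnorm u.
Proof.
move=> h1 h2 h3; rewrite hnorm_sum3E//.
have := @hnorm_ge0 R L2 u.1; have := @hnorm_ge0 R L2 u.2.1; have := @hnorm_ge0 R L2 u.2.2.
move: (hnorm _) (hnorm _) (hnorm _) => a b c c0 b0 a0.
have le (x y : R) : 0 <= x -> x ^+ 2 <= y -> x <= Num.sqrt y.
  by move=> x0 xy; rewrite -[x]ger0_norm// -sqrtr_sqr ler_wsqrtr.
have a2 := sqr_ge0 a; have b2 := sqr_ge0 b; have c2 := sqr_ge0 c.
have := le c (a ^+ 2 + b ^+ 2 + c ^+ 2) c0 ltac:(lra).
have := le b (a ^+ 2 + b ^+ 2 + c ^+ 2) b0 ltac:(lra).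
have := le a (a ^+ 2 + b ^+ 2 + c ^+ 2) a0 ltac:(lra).
lra.
Qed.

End ThreeSum.

(** * The resolvent of the block operator in the gap *)

Section BandGap.
Context {R : realType}.
Local Notation plane := (measurableTypeR R * measurableTypeR R)%type.
Local Notation mu := (@torus_measure R).
Variables (Omega1 Omega2 O1 : set plane) (a1 a2 b11 b12 c11 c12 : R) (k : plane).
Hypotheses (mO1 : measurable O1)
  (aeO1 : {ae mu, forall x, \1_Omega1 x = \1_O1 x :> R}).

Local Notation A := (opA Omega1 Omega2 a1 a2 b11 b12 k).
Local Notation AA := (opAA Omega1 Omega2 a1 a2 b11 b12 c11 c12 k).
Let s1 := Num.sqrt (c11 * b11 / a1).
Let s2 := Num.sqrt (c12 * b12 / a1).

(** With [opAA_intro] as partial converse, this trades the block operator, whose off-diagonal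
    entries involve an adjoint, for three equations almost everywhere in [L2]. *)
Lemma opAA_components u v : AA u v -> exists w : hsort (@L2 R),
  [/\ A u.1 w, [/\ @hmem R L2 u.1, @hmem R L2 u.2.1 & @hmem R L2 u.2.2],
      [/\ @hmem R L2 v.1, @hmem R L2 v.2.1 & @hmem R L2 v.2.2] &
      [/\ v.1 = w + s1%:C *: (u.2.1 : hsort (@L2 R)) + s2%:C *: (u.2.2 : hsort (@L2 R)) %[ae mu],
          v.2.1 = s1%:C *: restriction O1 u.1 + c11%:C *: (u.2.1 : hsort (@L2 R)) %[ae mu] &
          v.2.2 = s2%:C *: restriction O1 u.1 + c12%:C *: (u.2.2 : hsort (@L2 R)) %[ae mu]]].
Proof.
move=> [w [f1 [f2 [q1 [q2 [[hv1 [hv2 hv3]] [Aw B1 B2] [S1 S2] [e1 e2 e3]]]]]]].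
have [hy1 hf1 fE1] := opB_mem mO1 aeO1 B1.
have [hy2 hf2 fE2] := opB_mem mO1 aeO1 B2.
have [hu hq1 qE1] := opBstar_mem aeO1 S1.
have [_ hq2 qE2] := opBstar_mem aeO1 S2.
exists w; split=> //.
- by split=> //; [exact: ranP1_mem hy1|exact: ranP1_mem hy2].
- by split=> //; [exact: ranP1_mem hv2|exact: ranP1_mem hv3].
split.
- by rewrite e1; apply: filterS2 fE1 fE2 => x /= E1 E2 _; rewrite !L2E E1// E2.
- by rewrite e2; apply: filterS qE1 => x /= E1 _; rewrite [LHS]L2_addE E1.
- by rewrite e3; apply: filterS qE2 => x /= E1 _; rewrite [LHS]L2_addE E1.
Qed.

Lemma opAA_intro (u1 w y1 y2 : hsort (@L2 R)) : A u1 w ->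
  @hmem R (ranP1 Omega1) y1 -> @hmem R (ranP1 Omega1) y2 ->
  AA (u1, (y1 : hsort (ranP1 Omega1), y2 : hsort (ranP1 Omega1)))
     (w + s1%:C *: y1 + s2%:C *: y2,
      ((s1%:C *: restriction O1 u1 + c11%:C *: y1 : hsort (@L2 R)) : hsort (ranP1 Omega1),
       (s2%:C *: restriction O1 u1 + c12%:C *: y2 : hsort (@L2 R)) : hsort (ranP1 Omega1))).
Proof.
move=> Aw hy1 hy2; have [hu hw _] := Aw; have HL := @semi_inner_L2 R.
have hy1' := ranP1_mem hy1; have hy2' := ranP1_mem hy2.
have hP := ranP1_restriction mO1 aeO1 hu.
exists w, (s1%:C *: y1), (s2%:C *: y2), (s1%:C *: restriction O1 u1), (s2%:C *: restriction O1 u1).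
split.
- split=> /=; first by apply: (hmemD HL); [apply: (hmemD HL) => //|]; exact: (hmemZ HL).
  by split; apply: ranP1_lin => //; exact: ranP1Z.
- have B1 := @opB_scale R Omega1 O1 a1 mO1 aeO1 c11 b11 y1 hy1.
  have B2 := @opB_scale R Omega1 O1 a1 mO1 aeO1 c12 b12 y2 hy2.
  by split.
- by split; exact: opBstar_restriction.
- by [].
Qed.

Hypotheses (a1_gt0 : 0 < a1) (b11_gt0 : 0 < b11) (b12_gt0 : 0 < b12)
  (c11_gt0 : 0 < c11) (c12_gt0 : 0 < c12).
Variables (m l : R).
Hypotheses (sA : symmetric_operator A) (Am : lower_bounded A m)
  (res : forall x : R, x < m -> resolvent_set A x%:C)
  (cm : c12 < m) (cl : c11 < l)
  (lc : l < c11 + c11 * b11 / (c12 * b12 + c11 * b11) * (c12 - c11)).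

Let psi := - (s1 ^+ 2 / (c11 - l) + s2 ^+ 2 / (c12 - l)).

(** The endpoint is a convex combination of [c11] and [c12] with positive weight on [c11]. The proof
    clears the denominator and derives a contradiction from [c12 <= l]. *)
Lemma band_gap_lt : l < c12.
Proof.
have p1 := mulr_gt0 c11_gt0 b11_gt0; have p2 := mulr_gt0 c12_gt0 b12_gt0.
have p3 : 0 < c12 * b12 + c11 * b11 by rewrite addr_gt0.
move: lc; rewrite -ltrBlDl mulrAC ltr_pdivlMr// => H.
rewrite ltNge; apply/negP => c12l.
have c12l' : 0 <= l - c12 by rewrite subr_ge0.
have cl' : 0 < l - c11 by rewrite subr_gt0.
have := mulr_ge0 (ltW p1) c12l'; have := mulr_gt0 p2 cl'; lra.
Qed.

(** Over the common denominator, which is positive between [c11] and [c12], the numerator is affine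
    and decreasing in [l] and vanishes at the endpoint of the gap. *)
Lemma band_gap_psi_ge0 : 0 <= psi.
Proof.
have lc12 := band_gap_lt.
have p1 := mulr_gt0 c11_gt0 b11_gt0; have p2 := mulr_gt0 c12_gt0 b12_gt0.
have p3 : 0 < c12 * b12 + c11 * b11 by rewrite addr_gt0.
have k1 : 0 < l - c11 by rewrite subr_gt0.
have k2 : 0 < c12 - l by rewrite subr_gt0.
have -> : psi = (c11 * b11 * (c12 - l) - c12 * b12 * (l - c11)) /
    (a1 * (l - c11) * (c12 - l)).
  rewrite /psi /s1 /s2 !sqr_sqrtr ?divr_ge0 ?(ltW p1) ?(ltW p2) ?(ltW a1_gt0)//.
  have n1 : c11 - l != 0 by rewrite lt_eqF// subr_lt0.
  have n2 : c12 - l != 0 by rewrite gt_eqF.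
  have n3 : l - c11 != 0 by rewrite gt_eqF.
  have n4 : a1 != 0 by rewrite gt_eqF.
  by field; rewrite n1 n2 n3 n4.
rewrite divr_ge0 ?mulr_ge0 ?(ltW a1_gt0) ?(ltW k1) ?(ltW k2)//.
move: lc; rewrite -ltrBlDl mulrAC ltr_pdivlMr//; lra.
Qed.

Lemma opAA_resolvent : resolvent_set AA l%:C.
Proof.
have HL := @semi_inner_L2 R.
have lc12 := band_gap_lt; have psi0 := band_gap_psi_ge0.
have l0 : 0 <= l by rewrite ltW// (lt_trans c11_gt0).
have lm : l < m by exact: lt_trans cm.
have k10 : c11 - l != 0 by rewrite lt_eqF// subr_lt0.
have k20 : c12 - l != 0 by rewrite gt_eqF// subr_gt0.
have [M M0 HM] := schur_bound mO1 sA Am lm psi0 k10 k20 (erefl psi).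
split.
- move=> u v u' v' /opAA_components[w [Aw [hu hy1 hy2] [hv1 hv2 hv3] [e1 e2 e3]]].
  move=> /opAA_components[w' [Aw' [hu' hy1' hy2'] [hv1' hv2' hv3'] [e1' e2' e3']]] E.
  pose gg := (v - l%:C *: u) - (v' - l%:C *: u').
  have hB (p q p' q' : hsort (@L2 R)) : hmem p -> hmem q -> hmem p' -> hmem q' ->
      hmem ((p - l%:C *: q) - (p' - l%:C *: q')).
    by move=> hp hq hp' hq'; apply: (hmemB HL); apply: (hmemB HL) => //; exact: (hmemZ HL).
  have hg1 : @hmem R L2 gg.1
    by rewrite /gg !hsumE; exact: (hB v.1 u.1 v'.1 u'.1 hv1 hu hv1' hu').
  have hg2 : @hmem R L2 gg.2.1
    by rewrite /gg !hsumE; exact: (hB v.2.1 u.2.1 v'.2.1 u'.2.1 hv2 hy1 hv2' hy1').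
  have hg3 : @hmem R L2 gg.2.2
    by rewrite /gg !hsumE; exact: (hB v.2.2 u.2.2 v'.2.2 u'.2.2 hv3 hy2 hv3' hy2').
  have hd1 := hmemB HL hu hu'; have hd2 := hmemB HL hy1 hy1'; have hd3 := hmemB HL hy2 hy2'.
  (* Injectivity: the a priori bound for the difference of the two graph pairs, whose image under
     [AA - l] has norm zero by [E]. *)
  have ineq : hnorm (u.1 - u'.1 : hsort (@L2 R)) + hnorm (u.2.1 - u'.2.1 : hsort (@L2 R))
      + hnorm (u.2.2 - u'.2.2 : hsort (@L2 R)) <=
      M * (@hnorm R L2 gg.1 + @hnorm R L2 gg.2.1 + @hnorm R L2 gg.2.2).
    apply: (HM _ (w - w')) => //; first exact: symopB.
    + apply: filterS2 e1 e1' => x /= E1 E1' _.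
      by rewrite !L2E E1// E1'// !L2E; ring.
    + apply: filterS2 e2 e2' => x /= E1 E1' _.
      by rewrite /restriction !L2E E1// E1'// /restriction !L2E rmorphB; ring.
    + apply: filterS2 e3 e3' => x /= E1 E1' _.
      by rewrite /restriction !L2E E1// E1'// /restriction !L2E rmorphB; ring.
  apply/eqP; rewrite eq_le hnorm_ge0 andbT.
  apply: le_trans (hnorm_sum3_le (u := u - u') hd1 hd2 hd3) _.
  apply: le_trans ineq _.
  apply: le_trans (ler_wpM2l M0 (le_hnorm_sum3 hg1 hg2 hg3)) _.
  by rewrite E !mulr0.
- move=> f [hf1 [hf2 hf3]].
  have hf2' := ranP1_mem hf2; have hf3' := ranP1_mem hf3.
  have [u [w [Auw E hu]]] := schur_solve mO1 sA Am l0 lm psi0 (erefl psi) res hf1 hf2' hf3'.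
  pose y1 : hsort (@L2 R) :=
    (c11 - l)^-1%:C *: (f.2.1 : hsort (@L2 R)) - (s1 / (c11 - l))%:C *: restriction O1 u.
  pose y2 : hsort (@L2 R) :=
    (c12 - l)^-1%:C *: (f.2.2 : hsort (@L2 R)) - (s2 / (c12 - l))%:C *: restriction O1 u.
  have hP := ranP1_restriction mO1 aeO1 hu.
  have hy (s c : R) (g : hsort (@L2 R)) : @hmem R (ranP1 Omega1) g ->
      @hmem R (ranP1 Omega1) (c^-1%:C *: g - (s / c)%:C *: restriction O1 u).
    move=> hg; rewrite -scaleNr -rmorphN.
    by apply: ranP1_lin => //; exact: ranP1Z.
  have hy1 : @hmem R (ranP1 Omega1) y1 by exact: hy.
  have hy2 : @hmem R (ranP1 Omega1) y2 by exact: hy.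
  have AAuv := opAA_intro Auw hy1 hy2.
  (* The lower two rows hold as identities of functions; only the first row holds merely up to norm
     zero. *)
  have y0 (s c : R) (g : hsort (@L2 R)) : c - l != 0 ->
      let y := (c - l)^-1%:C *: g - (s / (c - l))%:C *: restriction O1 u in
      s%:C *: restriction O1 u + c%:C *: y - l%:C *: y - g = 0.
    move=> cl0 y; apply/funext => x; rewrite /y !L2E rmorphM /=.
    have kk : c%:C * ((c - l)^-1)%:C = 1 + l%:C * ((c - l)^-1)%:C :> R[i].
      by apply/eqP; rewrite -subr_eq -mulrBl -rmorphB -rmorphM mulfV.
    transitivity (0 : R[i]) => //.
    move: ((c - l)^-1)%:C kk => d kk; by ring: kk.
  eexists; eexists; split; first exact: AAuv.
  apply/eqP; rewrite eq_le hnorm_ge0 andbT.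
  have [_ hw] := symop_mem sA Auw.
  have hy1' := ranP1_mem hy1; have hy2' := ranP1_mem hy2.
  have E2 := y0 s1 c11 f.2.1 k10; have E3 := y0 s2 c12 f.2.2 k20.
  have E1 : w + s1%:C *: y1 + s2%:C *: y2 - l%:C *: u - f.1 =
      w - l%:C *: u + s1%:C *: y1 + s2%:C *: y2 - f.1.
    by congr (_ - _); rewrite addrAC; congr (_ + _); rewrite addrAC.
  apply: le_trans (hnorm_sum3_le _ _ _) _.
  - apply: (hmemB HL) => //; apply: (hmemB HL); last exact: (hmemZ HL).
    by apply: (hmemD HL); [apply: (hmemD HL) => //|]; exact: (hmemZ HL).
  - by rewrite [X in hmem X]E2; exact: (hmem0 HL).
  - by rewrite [X in hmem X]E3; exact: (hmem0 HL).
  rewrite [X in X + _ + _](_ : _ = 0); last by rewrite -[RHS]E; congr (hnorm _).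
  rewrite [X in _ + X + _](_ : _ = 0); last by rewrite -[RHS](hnorm0 HL); congr (hnorm _).
  rewrite [X in _ + X](_ : _ = 0); last by rewrite -[RHS](hnorm0 HL); congr (hnorm _).
  by rewrite !addr0.
(* The factor 3 passes from the sum of the component norms to the norm of the direct sum. *)
- exists (M * 3) => u v /opAA_components[w [Aw [hu hy1 hy2] [hv1 hv2 hv3] [e1 e2 e3]]].
  pose gg := v - l%:C *: u.
  have hB (p q : hsort (@L2 R)) : hmem p -> hmem q -> hmem (p - l%:C *: q).
    by move=> hp hq; apply: (hmemB HL) => //; exact: (hmemZ HL).
  have hg1 : @hmem R L2 gg.1
    by rewrite /gg !hsumE; exact: (hB v.1 u.1 hv1 hu).
  have hg2 : @hmem R L2 gg.2.1
    by rewrite /gg !hsumE; exact: (hB v.2.1 u.2.1 hv2 hy1).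
  have hg3 : @hmem R L2 gg.2.2
    by rewrite /gg !hsumE; exact: (hB v.2.2 u.2.2 hv3 hy2).
  apply: le_trans (hnorm_sum3_le hu hy1 hy2) _.
  rewrite -mulrA; apply: le_trans (ler_wpM2l M0 (le_hnorm_sum3 hg1 hg2 hg3)).
  apply: (HM _ w) => //.
  + apply: filterS e1 => x /= E1 _.
    by rewrite !L2E E1// !L2E; ring.
  + apply: filterS e2 => x /= E1 _.
    by rewrite /restriction !L2E E1// /restriction !L2E rmorphB; ring.
  + apply: filterS e3 => x /= E1 _.
    by rewrite /restriction !L2E E1// /restriction !L2E rmorphB; ring.
Qed.

End BandGap.

Unset Implicit Arguments.
Set Strict Implicit.
Set Printing Implicit Defensive.

Theorem mainTheorem5 (R : realType) (Omega1 Omega2 : set (measurableTypeR R * measurableTypeR R))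
    (a1 a2 b11 b12 c11 c12 : R)
    (mOmega1 : lebesgue_measurable2 Omega1)
    (mOmega2 : lebesgue_measurable2 Omega2)
    (partU : cell = Omega1 `|` Omega2) (partI : Omega1 `&` Omega2 = set0)
    (pos1 : ~ lebesgue2.-negligible Omega1)
    (pos2 : ~ lebesgue2.-negligible Omega2)
    (a1_gt0 : 0 < a1) (a2_gt0 : 0 < a2)
    (b11_gt0 : 0 < b11) (b12_gt0 : 0 < b12)
    (c11_gt0 : 0 < c11) (c12_gt0 : 0 < c12) (c11_lt_c12 : c11 < c12)
    (A_gt : forall k, quasimomenta k ->
       min_spectrum_gt (opA Omega1 Omega2 a1 a2 b11 b12 k) c12) :
  forall k, quasimomenta k ->
    [set lambda%:C | lambda in
       `]c11, c11 + c11 * b11 / (c12 * b12 + c11 * b11) * (c12 - c11)[ ]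
    `<=` resolvent_set (opAA Omega1 Omega2 a1 a2 b11 b12 c11 c12 k).
Proof.
move=> k Kk z [l Hl <-]; move: Hl; rewrite /= in_itv/= => /andP[cl lc].
have [B mB aeB] := lebesgue_measurable2_borel mOmega1.
have [m cm [Am res]] := opA_resolvent_set mB aeB partU partI a1_gt0 a2_gt0
  b11_gt0 b12_gt0 (A_gt k Kk).
have sA := opA_symmetric b11 b12 k mB aeB partU partI a1_gt0 a2_gt0.
exact: (opAA_resolvent mB aeB a1_gt0 b11_gt0 b12_gt0 c11_gt0 c12_gt0 sA Am res cm cl lc).
Qed.
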